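(* Consider the initial value problem for the Benjamin-Bona-Mahony equation $$\partial_t u+\partial_x u+u\partial_x u-\partial_x^2\partial_t u=0,\quad x,t\in\mathbb{R},\qquad u(x,0)=u_0(x).$$ Let $u_0\in H^s(\mathbb{R})$, $s\ge0$. If for $a<x_0<b$, $k\in\mathbb{Z}^+\cup\{0\}$ and $\theta\in[0,1)$ $$u_0\big|_{(a,x_0)},\ u_0\big|_{(x_0,b)}\in C^{k+\theta}\quad\text{and}\quad u_0\big|_{(a,b)}\notin C^{k+\theta},$$ then the corresponding solution $u\in C([0,T]:H^s(\mathbb{R}))$ of the initial value problem (described in the context) satisfies, for all $t\in[0,T]$, $$u(\cdot,t)\big|_{(a,x_0)},\ u(\cdot,t)\big|_{(x_0,b)}\in C^{k+\theta}\quad\text{and}\quad u(\cdot,t)\big|_{(a,b)}\notin C^{k+\theta}.$$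
   Context: The solution: by the well-posedness result of Bona and Tzvetkov, for any $u_0\in H^s(\mathbb{R})$, $s\ge0$, there exist $T=T(\|u_0\|_{s,2})>0$ (with $\|\cdot\|_{s,2}$ the $H^s(\mathbb{R})$ norm) and a unique solution $u\in C([0,T]:H^s(\mathbb{R}))$ of the initial value problem, and the map $u_0\mapsto u$ is locally continuous from $H^s(\mathbb{R})$ into $C([0,T]:H^s(\mathbb{R}))$. The equation is understood in the equivalent form $\partial_t u=-\partial_x(1-\partial_x^2)^{-1}(u+u^2/2)$, where $(1-\partial_x^2)^{-1}f=\frac12 e^{-|x|}*f$. For an open set $\Omega$, $C^{k+\theta}(\Omega)$ denotes the functions that are $k$ times continuously differentiable on $\Omega$ with $k$-th derivative (locally) Hölder continuous of exponent $\theta$ if $\theta>0$ (for $\theta=0$ this is $C^k(\Omega)$). Statements that an $L^2$ function is in $C^{k+\theta}$ on $\Omega$ refer to the existence of such a representative. *)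

(* Defs.v *)
From HB Require Import structures.
From mathcomp Require Import all_boot all_order all_algebra.
From mathcomp Require Import all_classical all_reals all_analysis.
Import Order.TTheory GRing.Theory Num.Theory.
Import numFieldNormedType.Exports.

Set Implicit Arguments.
Unset Strict Implicit.
Unset Printing Implicit Defensive.

Local Open Scope classical_set_scope.
Local Open Scope ring_scope.

(* Elements of L^2(R) are represented by functions f : R -> R with
   f \in Lfun mu 2; equality in L^2 is equality almost everywhere. *)

Definition L2norm (R : realType) (f : R -> R) : \bar R :=
  'N[@lebesgue_measure R]_(2%:E)[EFin \o f]%E.

(* Real and imaginary parts of the unitary Fourier integral
   (2 pi)^(-1/2) \int_(-A)^A f(x) e^(- i x xi) dx, which makes sense for every
   f in L^2. *)
Definition trunc_fourier_re (R : realType) (f : R -> R) (A xi : R) : R :=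
  (Num.sqrt (2 * pi))^-1 *
  (\int[@lebesgue_measure R]_(x in `[(- A)%R, A]) (f x * cos (x * xi)))%R.

Definition trunc_fourier_im (R : realType) (f : R -> R) (A xi : R) : R :=
  - ((Num.sqrt (2 * pi))^-1 *
  (\int[@lebesgue_measure R]_(x in `[(- A)%R, A]) (f x * sin (x * xi)))%R).

(* g.1 + i g.2 is the Fourier-Plancherel transform of f, i.e. the L^2 limit of
   the truncated Fourier integrals. *)
Definition is_fourier (R : realType) (f : R -> R) (g : (R -> R) * (R -> R)) :=
  [/\ g.1 \in Lfun (@lebesgue_measure R) 2%:E,
      g.2 \in Lfun (@lebesgue_measure R) 2%:E,
      L2norm (fun xi => g.1 xi - trunc_fourier_re f A xi) @[A --> +oo] --> 0%E &
      L2norm (fun xi => g.2 xi - trunc_fourier_im f A xi) @[A --> +oo] --> 0%E].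

(* || (1 + xi^2)^(s/2) \hat f ||_2. By uniqueness of L^2 limits \hat f is
   determined up to a null set, so that the infimum runs over the single value
   of this norm; it is +oo for functions without a transform. *)
Definition Hs_norm (R : realType) (s : R) (f : R -> R) : \bar R :=
  ereal_inf [set L2norm (fun xi => (1 + xi ^+ 2) `^ (s / 2) *
                                   Num.sqrt (g.1 xi ^+ 2 + g.2 xi ^+ 2))
            | g in [set g | is_fourier f g]].

(* The space H^s(R), for s >= 0. *)
Definition inHs (R : realType) (s : R) (f : R -> R) : Prop :=
  f \in Lfun (@lebesgue_measure R) 2%:E /\ (Hs_norm s f < +oo)%E.

(* t |-> u t belongs to C([0, T] : H^s(R)). *)
Definition continuous_Hs (R : realType) (s T : R) (u : R -> R -> R) : Prop :=
  forall t, t \in `[0, T] ->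
    inHs s (u t) /\
    Hs_norm s (fun x => u r x - u t x) @[r --> within `[0, T] (nbhs t)]
      --> 0%E.

(* (1 - d_x^2)^(-1) f = (e^(-|x|) / 2) * f *)
Definition helmholtz_inv (R : realType) (f : R -> R) (x : R) : R :=
  (\int[@lebesgue_measure R]_y (expR (- `|x - y|) / 2 * f y))%R.

(* - d_x (1 - d_x^2)^(-1) (v + v^2 / 2). The convolution is everywhere
   differentiable for v in L^2, so that d_x is the classical derivative. *)
Definition bbm_rhs (R : realType) (v : R -> R) (x : R) : R :=
  - derive1 (helmholtz_inv (fun y => v y + v y ^+ 2 / 2)) x.

(* u t : R -> R is the solution at time t. The time derivative is that of an
   L^2-valued curve: for a curve in C([0, T] : H^s), s >= 0, the right-hand side
   is continuous in t with values in H^s, and asking for the derivative in the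
   norm of H^s, or in the sense of distributions, gives the same solutions. *)
Definition bbm_solution (R : realType) (s T : R) (u0 : R -> R)
    (u : R -> R -> R) : Prop :=
  [/\ continuous_Hs s T u,
      u 0 = u0 %[ae @lebesgue_measure R] &
      forall t, t \in `]0, T[ ->
        L2norm (fun x => (u (t + h) x - u t x) / h - bbm_rhs (u t) x)
          @[h --> 0^'] --> 0%E].

Definition locally_holder (R : realType) (theta : R) (Omega : set R)
    (g : R -> R) : Prop :=
  forall x, Omega x -> exists C : R,
    \forall y \near x & z \near x, `|g y - g z| <= C * `|y - z| `^ theta.

(* Omega is meant to be open. *)
Definition Cktheta (R : realType) (k : nat) (theta : R) (Omega : set R)
    (g : R -> R) : Prop :=
  [/\ forall i x, (i < k)%N -> Omega x -> derivable (derive1n i g) x 1,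
      forall x, Omega x -> {for x, continuous (derive1n k g)} &
      0 < theta -> locally_holder theta Omega (derive1n k g)].

(* f restricted to Omega has a representative in C^(k + theta)(Omega). *)
Definition restr_in_Cktheta (R : realType) (k : nat) (theta : R)
    (Omega : set R) (f : R -> R) : Prop :=
  exists2 g : R -> R,
    {ae @lebesgue_measure R, forall x, Omega x -> g x = f x} &
    Cktheta k theta Omega g.

(* Main.v *)
Require Import Defs.
From HB Require Import structures.
From mathcomp Require Import all_boot all_order all_algebra.
From mathcomp Require Import all_classical all_reals all_analysis.
From mathcomp Require Import measurable_realfun.
From mathcomp Require Import ring lra.
Import Order.TTheory GRing.Theory Num.Theory.
Import numFieldNormedType.Exports.
Set Implicit Arguments.
Unset Strict Implicit.
Unset Printing Implicit Defensive.
Local Open Scope classical_set_scope.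
Local Open Scope ring_scope.

(** Let [w = v + v ^+ 2 / 2] be the flux of the state [v], [k = expR (- `|z|) / 2]
    the Green function of [1 - d_x^2] and [k'] its derivative. The equation reads
    [d_t u = - (k' * w)] with [w] the flux of [u t], so that [u t = u 0 + G t],
    where the drift [G t] is the time integral of [- (k' * w)]. Convolution with
    [k'] is smoothing, and it is so locally: the derivative of [k' * w] is
    [k * w - w], and the derivative of [k * w] is [k' * w], so that [k' * w] is of
    class C^(j+1) on an open interval as soon as [w] is of class C^j there,
    whatever [w] does elsewhere. By induction on [j], starting from the continuity
    of [k' * w], the drift is of class C^(k+1) on any open interval where [u 0] is
    of class C^k ([drift_bootstrap]). Since [theta < 1], adding the drift does not
    change membership in C^(k + theta). The same induction started from [u t]
    instead of [u 0] shows that [u 0] is in C^(k + theta) of an open interval if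
    and only if [u t] is ([regularity_propagates]). The theorem is this
    equivalence on ]a, x0[, ]x0, b[ and ]a, b[.

    The formula [u t = u 0 + G t] has to be deduced from the continuity of [u] in
    H^s and from its derivative in L^2. On a bounded interval [c, d], the
    L^1 norm of [u t - u 0 - G t] is a continuous function of [t], vanishes at [0]
    and has zero derivative ([defect_norm_derive]), hence is zero. The continuity
    up to the end points of [0, T] and the local bounds come from the continuity
    in L^2, and this requires half of Plancherel's theorem: the L^2 norm of [f] is
    at most a constant times that of its transform ([plancherel_Hs]). To prove it,
    the transforms of an integrable [h] and of a test function [p] are paired with
    the factor [expR (- e xi)] on the half-line; by Fubini this form
    [E(h, p)] is the pairing of [h] with the Poisson integral of [p]
    ([poisson_parseval]). Letting [e] tend to
    [0] in [2 E(h, p) <= E(h, h) + E(p, p)] gives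
    [2 pi <h, p> <= ||h^||^2 + pi ||p||^2] for bounded [p] of bounded support, and
    one takes for [h] a restriction of [f] and for [p] a cut-off of [f].

    Regularity in space has to be uniform in time to survive the time integral.
    It is expressed by the classes [time_Ck] of functions [H r x] that are C^k in
    [x] with values in the continuous functions of [r]. *)

(** * Lebesgue integrals over the line *)

Section L1.
Context {R : realType}.
Notation mu := (@lebesgue_measure R).
Notation L1 f := (mu.-integrable [set: R] (EFin \o f)).
Implicit Types f g h m : R -> R.

Lemma ae_mono (P Q : R -> Prop) : (forall x, P x -> Q x) ->
  {ae mu, forall x, P x} -> {ae mu, forall x, Q x}.
Proof. by move=> PQ; apply: filterS; first exact: (ae_filter_ringOfSetsType mu). Qed.

Lemma ae_and (P Q : R -> Prop) : {ae mu, forall x, P x} ->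
  {ae mu, forall x, Q x} -> {ae mu, forall x, P x /\ Q x}.
Proof. by move=> aP aQ; apply: filterI; first exact: (ae_filter_ringOfSetsType mu). Qed.

Lemma ae_all (P : R -> Prop) : (forall x, P x) -> {ae mu, forall x, P x}.
Proof.
by move=> aP; apply: filterE; first exact: (ae_filter_ringOfSetsType mu).
Qed.

Lemma L1_measurable f : L1 f -> measurable_fun [set: R] f.
Proof. by move/integrableP => [/measurable_EFinP]. Qed.

Lemma L1_le f g : measurable_fun [set: R] f ->
  (forall x, `|f x| <= g x) -> L1 g -> L1 f.
Proof.
move=> mf fg gi; apply: (le_integrable _ _ _ gi) => //.
  exact/measurable_EFinP.
by move=> x _ /=; rewrite lee_fin (le_trans (fg x))// ler_norm.
Qed.

Lemma L1D f g : L1 f -> L1 g -> L1 (fun x => f x + g x).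
Proof. by move=> fi gi; have := integrableD measurableT fi gi. Qed.

Lemma L1B f g : L1 f -> L1 g -> L1 (fun x => f x - g x).
Proof. by move=> fi gi; have := integrableB measurableT fi gi. Qed.

Lemma L1Z (k : R) f : L1 f -> L1 (fun x => k * f x).
Proof. by move=> fi; have := integrableZl measurableT k fi. Qed.

Lemma L1M f m (M : R) : L1 f -> measurable_fun [set: R] m ->
  (forall x, `|m x| <= M) -> L1 (fun x => m x * f x).
Proof.
move=> fi mm mM; apply: (@L1_le _ (fun x => M * `|f x|)).
- by apply: measurable_funM => //; exact: L1_measurable.
- by move=> x; rewrite normrM ler_wpM2r.
- by apply: L1Z; exact: integrable_norm.
Qed.

Lemma L1_eq f g : f =1 g -> L1 f -> L1 g.
Proof. by move=> /funext ->. Qed.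

Lemma RintegralT_le f g : L1 f -> L1 g -> (forall x, f x <= g x) ->
  \int[mu]_x f x <= \int[mu]_x g x.
Proof. by move=> fi gi fg; apply: le_Rintegral => //. Qed.

Lemma RintegralT_norm_le f g : L1 f -> L1 g -> (forall x, `|f x| <= g x) ->
  `|\int[mu]_x f x| <= \int[mu]_x g x.
Proof.
move=> fi gi fg; apply: (le_trans (le_normr_Rintegral _ fi)) => //.
by apply: le_Rintegral => //; exact: integrable_norm.
Qed.

Lemma RintegralT_ae_eq f g : L1 f -> measurable_fun [set: R] g ->
  {ae mu, forall x, f x = g x} -> \int[mu]_x f x = \int[mu]_x g x.
Proof.
move=> fi mg fg; congr fine; apply: ae_eq_integral => //.
- exact: (measurable_int mu).
- exact/measurable_EFinP.
- by case: fg => N [mN N0 fgN]; exists N; split=> // x /= nfg; apply: fgN => /= fgx; apply: nfg => _; rewrite fgx.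
Qed.

Lemma RintegralT_dominated_cvg (F : nat -> R -> R) f g :
  (forall n, measurable_fun [set: R] (F n)) -> measurable_fun [set: R] f ->
  L1 g -> {ae mu, forall x, F n x @[n --> \oo] --> f x} ->
  (forall n x, `|F n x| <= g x) ->
  L1 f /\ \int[mu]_x F n x @[n --> \oo] --> \int[mu]_x f x.
Proof.
move=> mF mf gi Ff Fg.
have Ff' : {ae mu, forall x, [set: R] x -> (EFin \o F n) x @[n --> \oo] --> (EFin \o f) x}.
  by apply: ae_mono Ff => x /= ? _; apply: cvg_EFin => //; exact: nearW.
have Fg' : {ae mu, forall x n, [set: R] x -> (`|(EFin \o F n) x| <= (EFin \o g) x)%E}.
  by apply: ae_all => x n _ /=; rewrite lee_fin.
have mF' n : measurable_fun [set: R] (EFin \o F n) by exact/measurable_EFinP.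
have mf' : measurable_fun [set: R] (EFin \o f) by exact/measurable_EFinP.
have [fi _ cv] := @dominated_convergence _ _ _ mu setT measurableT
  (fun n => EFin \o F n) (EFin \o f) (EFin \o g) mF' mf' Ff' gi Fg'.
split=> //; apply: fine_cvg; rewrite fineK //.
exact: integrable_fin_num.
Qed.

End L1.

Section Fubini.
Context {R : realType}.
Notation mu := (@lebesgue_measure R).
Notation L1 f := (mu.-integrable [set: R] (EFin \o f)).
Implicit Types a b : R -> R.

Lemma measurable_slice (m : R -> R -> R) (x : R) :
  measurable_fun [set: R * R] (fun z => m z.1 z.2) ->
  measurable_fun [set: R] (m x).
Proof.
move=> mm; exact: (measurableT_comp mm (measurable_fun_pair (measurable_cst x) (@measurable_id _ _ setT))).
Qed.

Lemma RintegralT_EFin f : L1 f -> (\int[mu]_x (f x)%:E)%E = (\int[mu]_x f x)%:E.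
Proof. by move=> fi; rewrite fineK//; exact: integrable_fin_num. Qed.

(** Multiplying a bounded kernel by one integrable function in each variable
    makes it integrable for the product measure. All the exchanges of integrals
    below are put in this form, a weight being split off if necessary. *)
Lemma Fubini_bounded_kernel a b (m : R -> R -> R) (M : R) : L1 a -> L1 b ->
  measurable_fun [set: R * R] (fun z => m z.1 z.2) ->
  (forall x y, `|m x y| <= M) ->
  L1 (fun x => a x * \int[mu]_y (m x y * b y)) /\
  \int[mu]_x (a x * \int[mu]_y (m x y * b y)) =
  \int[mu]_y (b y * \int[mu]_x (m x y * a x)).
Proof.
move=> ai bi mm mM.
pose f (z : R * R) : \bar R := (a z.1 * (m z.1 z.2 * b z.2))%:E.
have M0 : 0 <= M by rewrite (le_trans _ (mM 0 0)).
have ma := L1_measurable ai; have mb := L1_measurable bi.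
have mf : measurable_fun [set: R * R] f.
  apply/measurable_EFinP; apply: measurable_funM.
    by apply: measurableT_comp ma _; exact: measurable_fst.
  apply: measurable_funM => //.
  by apply: measurableT_comp mb _; exact: measurable_snd.
have mx x : measurable_fun [set: R] (m x) by exact: measurable_slice.
have my y : measurable_fun [set: R] (m^~ y).
  apply: (@measurable_slice (fun y x => m x y)).
  exact: (measurableT_comp mm (measurable_fun_pair measurable_snd measurable_fst)).
have mbi x : L1 (fun y => m x y * b y) by exact: (L1M bi (mx x) (mM x)).
have mai y : L1 (fun x => m x y * a x) by exact: (L1M ai (my y) (mM ^~ y)).
have E1 x : (\int[mu]_y f (x, y) = (a x * \int[mu]_y (m x y * b y))%:E)%E.
  by rewrite /f/= -RintegralZl// -RintegralT_EFin //; exact: L1Z.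
have E2 y : (\int[mu]_x f (x, y) = (b y * \int[mu]_x (m x y * a x))%:E)%E.
  rewrite -RintegralZl// -RintegralT_EFin //; last exact: L1Z.
  by apply: eq_integral => x _; rewrite /f /= mulrCA [in RHS]mulrCA (mulrC (a x)).
have fi : (mu \x mu)%E.-integrable setT f.
  apply/integrable12ltyP => //.
  have H := L1Z (M * \int[mu]_y `|b y|) (integrable_norm ai).
  apply: (le_lt_trans _ (integrable_lty measurableT H)).
  apply: ge0_le_integral => //.
  - by move=> x _; exact: integral_ge0.
  - apply: (@measurable_fun_fubini_tonelli_F _ _ _ _ _ mu (abse \o f)).
      exact: measurableT_comp.
    by move=> z; exact: abse_ge0.
  - exact: (measurable_int mu H).
  - move=> x _ /=.
    have nb : L1 (fun y => M * `|a x| * `|b y|).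
      exact/L1Z/integrable_norm.
    apply: (@le_trans _ _ (\int[mu]_y (M * `|a x| * `|b y|)%:E)%E).
      apply: ge0_le_integral => //.
      + apply/measurable_EFinP; apply: measurableT_comp => //.
        exact: (L1_measurable (L1Z (a x) (mbi x))).
      + exact: (measurable_int mu nb).
      + move=> y _; rewrite /f /= lee_fin !normrM mulrA (mulrC M).
        by rewrite ler_wpM2r // ler_wpM2l.
    rewrite RintegralT_EFin// RintegralZl//; last exact: integrable_norm.
    by rewrite lee_fin mulrAC.
split.
  have := integrable_fubini_F fi; apply: eq_integrable => // x _.
  by rewrite /fubini_F E1.
rewrite /Rintegral; congr fine.
under eq_integral do rewrite -E1; under [RHS]eq_integral do rewrite -E2.
exact: Fubini.
Qed.

End Fubini.

(** * The fundamental theorem of calculus *)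

Section incr.
Context {R : realType}.
Notation mu := (@lebesgue_measure R).
Notation L1 f := (mu.-integrable [set: R] (EFin \o f)).

Lemma L1_itv (f : R -> R) (p q : R) : L1 f -> mu.-integrable `[p, q] (EFin \o f).
Proof. by apply: integrableS. Qed.

(** Functions given by their increments: this and the next lemma serve for
    convolutions, whose increments are computed by Fubini as integrals of other
    convolutions, so that no derivative is taken under a convolution integral. *)
Lemma incr_continuous (F f : R -> R) (c d : R) :
  mu.-integrable `[c, d] (EFin \o f) ->
  (forall p q, c <= p -> p <= q -> q <= d -> F q - F p = \int[mu]_(y in `[p, q]) f y) ->
  forall x, c < x < d -> {for x, continuous F}.
Proof.
move=> fi FE x /andP[cx xd].
have cd : c < d by apply: lt_trans xd.
have := parameterized_integral_continuous (ltW cd) fi.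
move=> /continuous_within_itvP => /(_ cd)[+ _ _].
move=> /(_ x); rewrite in_itv/= cx xd => /(_ isT) cint.
have H : {for x, continuous (fun y => F c + \int[mu]_(z in `[c, y]) f z)}.
  by apply: cvgD; [exact: cvg_cst|exact: cint].
rewrite /prop_for /continuous_at in H *.
rewrite -[X in _ --> X](_ : F c + \int[mu]_(z in `[c, x]) f z = _); last first.
  by rewrite -FE ?lexx ?ltW// addrC subrK.
apply: cvg_trans H; apply: near_eq_cvg; near=> y.
have cy : c < y by near: y; exact: lt_nbhsr.
have yd : y < d by near: y; exact: lt_nbhsl.
by rewrite -FE ?lexx ?ltW// addrC subrK.
Unshelve. all: by end_near. Qed.

Lemma incr_derive (F f : R -> R) (c d : R) :
  mu.-integrable `[c, d] (EFin \o f) ->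
  (forall p q, c <= p -> p <= q -> q <= d -> F q - F p = \int[mu]_(y in `[p, q]) f y) ->
  forall x, c < x < d -> {for x, continuous f} -> is_derive x 1 F (f x).
Proof.
move=> fi FE x /andP[cx xd] fx.
have [dF F'] := continuous_FTC1_closed xd fi cx fx.
have H : is_derive x 1 (fun y => F c + \int[mu]_(z in `[c, y]) f z) (f x).
  rewrite -[f x]add0r; apply: is_deriveD.
  by apply: DeriveDef; [exact: dF|rewrite -derive1E].
apply: near_eq_is_derive H.
near=> y.
have cy : c < y by near: y; exact: lt_nbhsr.
have yd : y < d by near: y; exact: lt_nbhsl.
by rewrite -FE ?lexx ?ltW// addrC subrK.
Unshelve. all: by end_near. Qed.

Lemma is_derive_continuous (F : R -> R) (x d : R) : is_derive x 1 F d -> {for x, continuous F}.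
Proof. by move=> [dF _]; apply: differentiable_continuous; exact/derivable1_diffP. Qed.

Lemma FTC2_global (F f : R -> R) (p q : R) : p <= q -> continuous f ->
  (forall x : R, is_derive x 1 F (f x)) -> \int[mu]_(y in `[p, q]) f y = F q - F p.
Proof.
rewrite le_eqVlt => /predU1P[<-|pq] cf dF.
  by rewrite subrr set_itv1 Rintegral_set1.
have cF : continuous F by move=> x; exact: is_derive_continuous.
rewrite /Rintegral (@continuous_FTC2 _ f F p q)//.
- exact: continuous_subspaceT.
- split; first by move=> x _; case: (dF x).
  + exact/cvg_at_right_filter/cF.
  + exact/cvg_at_left_filter/cF.
- by move=> x _; rewrite derive1E; case: (dF x).
Qed.

Lemma FTC2y_global (F f : R -> R) (a l : R) : (forall x, a <= x -> 0 <= f x) ->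
  continuous f -> (forall x : R, is_derive x 1 F (f x)) -> F x @[x --> +oo] --> l ->
  (\int[mu]_(y in `[a, +oo[) (f y)%:E = l%:E - (F a)%:E)%E.
Proof.
move=> f0 cf dF Fl.
have cF : continuous F by move=> x; exact: is_derive_continuous.
apply: ge0_continuous_FTC2y => //.
- exact: continuous_subspaceT.
- exact/cvg_at_right_filter/cF.
- by move=> x _; rewrite derive1E; case: (dF x).
Qed.
End incr.

(** * Convolution with the Green function of [1 - d_x^2] and its derivative *)

Section kernel.
Context {R : realType}.
Notation mu := (@lebesgue_measure R).
Notation L1 f := (mu.-integrable [set: R] (EFin \o f)).

Lemma L1_expR_Nnorm : L1 (fun y => expR (- `|y|)).
Proof.
have ce : continuous (fun y : R => expR (- `|y|)).
  move=> y; apply: continuous_comp; last exact: continuous_expR.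
  apply: continuousN; exact: norm_continuous.
apply/integrableP; split.
  by apply/measurable_EFinP; exact: continuous_measurable_fun.
under eq_integral do rewrite gee0_abs ?lee_fin ?expR_ge0//.
have e0 (y : R) : 0 <= expR (- `|y|) by exact: expR_ge0.
have eE : (fun y : R => expR (- `|y|)) =1 (fun y => expR (- `|y|)) \o -%R.
  by move=> y /=; rewrite normrN.
rewrite (ge0_symfun_integralT e0 ce eE).
rewrite -set_itvcy.
have dF (x : R) : is_derive x 1 (fun y : R => - expR (- y)) (expR (- x)).
  by apply: is_derive_eq; rewrite mulrN1 opprK.
have cf : continuous (fun y : R => expR (- y)).
  by move=> y; apply: continuous_comp; [exact: continuousN|exact: continuous_expR].
have Fl : - expR (- x) @[x --> +oo] --> (0 : R).
  by rewrite -oppr0; apply: cvgN; exact: cvgr_expR.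
have f0 (x : R) : 0 <= x -> 0 <= expR (- x) by move=> _; exact: expR_ge0.
have E := FTC2y_global f0 cf dF Fl.
rewrite (_ : (\int[mu]_(x in `[0%R, +oo[) _)%E = (0%:E - (- expR (- 0))%:E)%E).
  by rewrite -EFinB -EFinM ltry.
by rewrite -E; apply: eq_integral => y; rewrite inE/= in_itv/= andbT => y0; rewrite ger0_norm.
Qed.
End kernel.

Section convol.
Context {R : realType}.
Notation mu := (@lebesgue_measure R).
Notation L1 f := (mu.-integrable [set: R] (EFin \o f)).
Implicit Types k w : R -> R.

(** The flux [v + v ^+ 2 / 2] of a square integrable [v] is in L^1 + L^2 only; with
    this weight it becomes integrable, and the weight costs no more than a factor
    [expR `|x|] in a convolution with an exponentially decaying kernel. *)
Definition expR_weight (w : R -> R) : R -> R := fun y => expR (- `|y|) * w y.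

Definition convol (k w : R -> R) (x : R) : R := \int[mu]_y (k (x - y) * w y).

Lemma expR_shift (x y : R) : expR (- `|x - y|) <= expR `|x| * expR (- `|y|).
Proof.
rewrite -expRD ler_expR.
have := ler_normD (y - x) x; rewrite subrK distrC; lra.
Qed.

Lemma expR_weight_measurable w : L1 (expR_weight w) -> measurable_fun [set: R] w.
Proof.
move=> /L1_measurable mw.
rewrite (_ : w = (fun y => expR `|y| * expR_weight w y)); last first.
  by apply/funext => y; rewrite /expR_weight mulrA -expRD subrr expR0 mul1r.
apply: measurable_funM => //; apply: measurableT_comp => //.
Qed.

Lemma L1_convol k w x : measurable_fun [set: R] k ->
  (forall z, `|k z| <= expR (- `|z|)) -> L1 (expR_weight w) ->
  L1 (fun y => k (x - y) * w y).
Proof.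
move=> mk kb wi; apply: (@L1_le _ _ (fun y => expR `|x| * `|expR_weight w y|)).
- apply: measurable_funM; last exact: expR_weight_measurable.
  by apply: measurableT_comp mk _; exact: measurable_funB.
- move=> y; rewrite normrM /expR_weight normrM (ger0_norm (expR_ge0 _)) mulrA.
  by rewrite ler_wpM2r// (le_trans (kb _))// expR_shift.
- by apply: L1Z; exact: integrable_norm.
Qed.

Lemma convol_bound k w x : measurable_fun [set: R] k ->
  (forall z, `|k z| <= expR (- `|z|)) -> L1 (expR_weight w) ->
  `|convol k w x| <= expR `|x| * \int[mu]_y `|expR_weight w y|.
Proof.
move=> mk kb wi; rewrite -RintegralZl//; last exact: integrable_norm.
apply: RintegralT_norm_le; first exact: L1_convol.
  by apply: L1Z; exact: integrable_norm.
move=> y; rewrite normrM /expR_weight normrM (ger0_norm (expR_ge0 _)) mulrA.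
by rewrite ler_wpM2r// (le_trans (kb _))// expR_shift.
Qed.

(** Integrating a convolution amounts to integrating its kernel. The weight
    [expR (- `|s|)] goes to [w]; its inverse times [k (y - s)] is bounded on the
    strip [p <= y <= q]. *)
Lemma Rintegral_convol k w (p q : R) : measurable_fun [set: R] k ->
  (forall z, `|k z| <= expR (- `|z|)) -> L1 (expR_weight w) ->
  mu.-integrable `[p, q] (EFin \o convol k w) /\
  \int[mu]_(y in `[p, q]) convol k w y =
  \int[mu]_s ((\int[mu]_(y in `[p, q]) k (y - s)) * w s).
Proof.
move=> mk kb wi.
pose a : R -> R := \1_(`[p, q]).
have ai : L1 a by exact: integrable_indic_itv.
have ma := L1_measurable ai.
pose m y s := a y * k (y - s) * expR `|s|.
have a01 y : a y = (y \in `[p, q])%:R.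
  by rewrite /a indicE mem_setE.
have restE (f : R -> R) y : (f \_ `[p, q]) y = a y * f y.
  by rewrite patchE mem_setE a01; case: (boolP (y \in `[p, q])) => _; rewrite ?mul1r ?mul0r.
have aa y : a y * a y = a y.
  by rewrite a01; case: (_ \in _); rewrite ?mulr1 ?mulr0.
have mm : measurable_fun [set: R * R] (fun z => m z.1 z.2).
  apply: measurable_funM; first apply: measurable_funM.
  - by apply: measurableT_comp ma _; exact: measurable_fst.
  - apply: measurableT_comp mk _; apply: measurable_funB; [exact: measurable_fst|exact: measurable_snd].
  - apply: measurableT_comp => //; apply: measurableT_comp => //; exact: measurable_snd.
(* a bound of [`|y|] on [p, q], which dominates the inverse weight *)
pose M := expR (Num.max `|p| `|q|).
have mM y s : `|m y s| <= M.
  rewrite /m a01; have [yp|_] := boolP (y \in `[p, q]); last by rewrite !mul0r normr0 expR_ge0.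
  rewrite mul1r normrM (ger0_norm (expR_ge0 _)).
  apply: (@le_trans _ _ (expR `|y|)).
    apply: (@le_trans _ _ (expR `|y| * expR (- `|s|) * expR `|s|)).
      by rewrite ler_wpM2r ?expR_ge0// (le_trans (kb _))// expR_shift.
    by rewrite -mulrA -expRD addrC subrr expR0 mulr1.
  rewrite ler_expR; move: yp; rewrite in_itv/= => /andP[py yq].
  rewrite le_max; have [y0|y0] := leP 0 y.
    by apply/orP; right; rewrite (ger0_norm y0) (le_trans yq)// ler_norm.
  by apply/orP; left; rewrite (ltr0_norm y0) -(normrN p) (le_trans _ (ler_norm (- p)))//; lra.
have [Ci CE] := Fubini_bounded_kernel ai wi mm mM.
have E1 y : a y * \int[mu]_s (m y s * expR_weight w s) = a y * convol k w y.
  rewrite a01; have [yp|_] := boolP (y \in `[p, q]); last by rewrite !mul0r.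
  rewrite !mul1r /convol; apply: eq_Rintegral => s _.
  by rewrite /m a01 yp mul1r /expR_weight -!mulrA (mulrA (expR _)) -expRD subrr expR0 mul1r.
have E2 s : expR_weight w s * \int[mu]_y (m y s * a y) = (\int[mu]_(y in `[p, q]) k (y - s)) * w s.
  rewrite [in RHS]Rintegral_mkcond.
  have ri : L1 (fun y => k (y - s) * a y).
    apply: (@L1M _ _ _ 1) => //.
      by apply: measurableT_comp mk _; exact: measurable_funB.
    move=> y; rewrite (le_trans (kb _))// -expR0 ler_expR; have := normr_ge0 (y - s); lra.
  transitivity (expR_weight w s * (expR `|s| * \int[mu]_y (k (y - s) * a y))).
    rewrite -(RintegralZl (expR `|s|) measurableT ri); congr (_ * _); apply: eq_Rintegral => y _.
    by rewrite /m -[in RHS]aa; ring.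
  rewrite mulrCA mulrA /expR_weight mulrA -expRD subrr expR0 mul1r mulrC; congr (_ * _).
  by apply: eq_Rintegral => y _; rewrite restE mulrC.
split.
  apply/(integrable_mkcond _ _).2 => //.
  apply: eq_integrable Ci => // y _ /=; rewrite restrict_EFin /= E1.
  by rewrite restE.
rewrite Rintegral_mkcond.
rewrite (_ : \int[mu]_y _ = \int[mu]_x (a x * \int[mu]_y (m x y * expR_weight w y))); last first.
  by apply: eq_Rintegral => y _; rewrite E1 restE.
by rewrite CE; apply: eq_Rintegral => s _; rewrite E2.
Qed.

End convol.

Section kernels.
Context {R : realType}.
Notation mu := (@lebesgue_measure R).
Notation L1 f := (mu.-integrable [set: R] (EFin \o f)).
Implicit Types k w : R -> R.

Lemma ae_neq (s : R) : {ae mu, forall y, y <> s}.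
Proof.
exists [set s]; split; [exact: measurable_set1|exact: lebesgue_measure_set1|].
by move=> y /= /contrapT.
Qed.

Lemma Rintegral_itv_eq_off_point (f g : R -> R) (p q s : R) : measurable_fun [set: R] f ->
  measurable_fun [set: R] g -> (forall y, p <= y <= q -> y <> s -> f y = g y) ->
  \int[mu]_(y in `[p, q]) f y = \int[mu]_(y in `[p, q]) g y.
Proof.
move=> mf mg fg; congr fine; apply: ae_eq_integral => //.
- by apply/measurable_EFinP; exact: measurable_funTS.
- by apply/measurable_EFinP; exact: measurable_funTS.
- apply: ae_mono (ae_neq s) => y ys /=; rewrite in_itv/= => ypq.
  by rewrite fg.
Qed.

(** The kernels below are smooth on both sides of a point [s] only. The two
    antiderivatives agree at [s], so the boundary terms at [s] cancel. *)
Lemma FTC2_split (f f1 F1 f2 F2 : R -> R) (s p q : R) : p <= q ->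
  measurable_fun [set: R] f -> mu.-integrable `[p, q] (EFin \o f) ->
  (forall y, y < s -> f y = f1 y) -> (forall y, s < y -> f y = f2 y) ->
  continuous f1 -> continuous f2 ->
  (forall x : R, is_derive x 1 F1 (f1 x)) -> (forall x : R, is_derive x 1 F2 (f2 x)) ->
  F1 s = F2 s ->
  \int[mu]_(y in `[p, q]) f y =
    (if q < s then F1 q else F2 q) - (if p < s then F1 p else F2 p).
Proof.
move=> pq mf fi ff1 ff2 cf1 cf2 dF1 dF2 Fs.
have mf1 : measurable_fun [set: R] f1 by exact: continuous_measurable_fun.
have mf2 : measurable_fun [set: R] f2 by exact: continuous_measurable_fun.
have le1 p' q' : p' <= q' -> q' <= s -> \int[mu]_(y in `[p', q']) f y = F1 q' - F1 p'.
  move=> pq' qs; rewrite -(FTC2_global pq' cf1 dF1).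
  apply: (Rintegral_itv_eq_off_point (s := s)) => // y /andP[_ yq] /eqP ys.
  by rewrite ff1// lt_neqAle ys (le_trans yq).
have le2 p' q' : p' <= q' -> s <= p' -> \int[mu]_(y in `[p', q']) f y = F2 q' - F2 p'.
  move=> pq' qs; rewrite -(FTC2_global pq' cf2 dF2).
  apply: (Rintegral_itv_eq_off_point (s := s)) => // y /andP[yp _] /eqP ys.
  by rewrite ff2// lt_neqAle eq_sym ys (le_trans qs).
have [qs|sq] := ltP q s; first by rewrite (le_lt_trans pq qs) le1 // ltW.
have [ps|sp] := ltP p s; last by rewrite le2.
have := @Rintegral_itvB _ f (BLeft p) (BRight q) s fi.
rewrite !bnd_simp => /(_ (ltW ps) sq) E.
have sqi : mu.-integrable `]s, q] (EFin \o f).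
  apply: integrableS fi => //; apply: subset_itvr; rewrite bnd_simp; exact: ltW.
rewrite (Rintegral_itv_obnd_cbnd sqi) (le1 _ _ (ltW ps) (lexx s)) in E.
rewrite (le2 _ _ sq (lexx s)) in E.
by move/eqP : E; rewrite subr_eq => /eqP ->; rewrite Fs addrA addrNK.
Qed.

(** The Green function of [1 - d_x^2]. *)
Definition helmholtz (z : R) : R := expR (- `|z|) / 2.
(** The derivative of [helmholtz] off the origin. *)
Definition dhelmholtz (z : R) : R := - Num.sg z * helmholtz z.

Lemma measurable_helmholtz : measurable_fun [set: R] helmholtz.
Proof.
apply: measurable_funM => //; apply: measurableT_comp => //.
exact: measurableT_comp.
Qed.

Lemma helmholtz_bound z : `|helmholtz z| <= expR (- `|z|).
Proof.
rewrite ger0_norm /helmholtz; have := expR_ge0 (- `|z|); lra.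
Qed.

Lemma measurable_sg : measurable_fun [set: R] (@Num.sg R).
Proof.
rewrite (_ : Num.sg = fun x : R => \1_(`]0, +oo[) x - \1_(`]-oo, 0[) x).
  by apply: measurable_funB; exact: measurable_indic.
apply/funext => x; rewrite !indicE !mem_setE !in_itv/= andbT.
have [x0|x0|<-] := ltrgtP 0 x; [rewrite gtr0_sg//|rewrite ltr0_sg//|rewrite sgr0];
  rewrite /=; lra.
Qed.

Lemma measurable_dhelmholtz : measurable_fun [set: R] dhelmholtz.
Proof.
apply: measurable_funM; last exact: measurable_helmholtz.
by apply: measurableT_comp => //; exact: measurable_sg.
Qed.

Lemma dhelmholtz_bound z : `|dhelmholtz z| <= expR (- `|z|).
Proof.
rewrite normrM normrN normr_sg; apply: le_trans (helmholtz_bound z).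
by case: (_ != _); rewrite ?mul1r ?mul0r.
Qed.

Lemma shifted_kernel_integrable k (p q s : R) : measurable_fun [set: R] k ->
  (forall z, `|k z| <= expR (- `|z|)) ->
  measurable_fun [set: R] (fun y => k (y - s)) /\
  mu.-integrable `[p, q] (EFin \o (fun y => k (y - s))).
Proof.
move=> mk kb.
have mks : measurable_fun [set: R] (fun y => k (y - s)).
  by apply: measurableT_comp mk _; exact: measurable_funB.
split=> //; apply: measurable_bounded_integrable => //.
- by rewrite /= lebesgue_measure_itv/=; case: ifPn; rewrite ?ltry.
- exact: measurable_funTS.
- exists 1; split=> // M M1 y _ /=; rewrite (le_trans (kb _))// (le_trans _ (ltW M1))//.
Qed.

(** An antiderivative of [helmholtz] is [helmholtz z] for [z < 0] and [1 - helmholtz z] for [z >= 0],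
    that is [dhelmholtz] plus a unit jump: this jump is the Dirac mass in
    [(1 - d_x^2) helmholtz]. *)
Lemma Rintegral_helmholtz (p q s : R) : p <= q -> \int[mu]_(y in `[p, q]) helmholtz (y - s) =
  (if q < s then helmholtz (q - s) else 1 - helmholtz (q - s)) -
  (if p < s then helmholtz (p - s) else 1 - helmholtz (p - s)).
Proof.
move=> pq; have [mks ki] := shifted_kernel_integrable p q s measurable_helmholtz helmholtz_bound.
have c1 : continuous (fun y => expR (y - s) / 2).
  by move=> y; apply: is_derive_continuous.
have c2 : continuous (fun y => expR (s - y) / 2).
  by move=> y; apply: is_derive_continuous.
have d1 (x : R) : is_derive x 1 (fun y => expR (y - s) / 2) (expR (x - s) / 2).
  by apply: is_derive_eq; rewrite /GRing.scale /=; ring.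
have d2 (x : R) : is_derive x 1 (fun y => 1 - expR (s - y) / 2) (expR (s - x) / 2).
  apply: is_derive_eq; rewrite /GRing.scale /=; ring.
have f1 y : y < s -> helmholtz (y - s) = expR (y - s) / 2.
  by move=> ys; rewrite /helmholtz ltr0_norm ?subr_lt0// opprK.
have f2 y : s < y -> helmholtz (y - s) = expR (s - y) / 2.
  by move=> ys; rewrite /helmholtz gtr0_norm ?subr_gt0// opprB.
rewrite (FTC2_split pq mks ki f1 f2 c1 c2 d1 d2); last first.
  by rewrite subrr expR0; lra.
have E y : (if y < s then expR (y - s) / 2 else 1 - expR (s - y) / 2) = (if y < s then helmholtz (y - s) else 1 - helmholtz (y - s)).
  case: ifPn => [/f1 ->//|]; rewrite -leNgt => sy.
  by rewrite /helmholtz ger0_norm ?subr_ge0// opprB.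
by rewrite !E.
Qed.

Lemma Rintegral_dhelmholtz (p q s : R) : p <= q ->
  \int[mu]_(y in `[p, q]) dhelmholtz (y - s) = helmholtz (q - s) - helmholtz (p - s).
Proof.
move=> pq; have [mks ki] := shifted_kernel_integrable p q s measurable_dhelmholtz dhelmholtz_bound.
have c1 : continuous (fun y => expR (y - s) / 2).
  by move=> y; apply: is_derive_continuous.
have c2 : continuous (fun y => - (expR (s - y) / 2)).
  by move=> y; apply: is_derive_continuous.
have d1 (x : R) : is_derive x 1 (fun y => expR (y - s) / 2) (expR (x - s) / 2).
  by apply: is_derive_eq; rewrite /GRing.scale /=; ring.
have d2 (x : R) : is_derive x 1 (fun y => expR (s - y) / 2) (- (expR (s - x) / 2)).
  by apply: is_derive_eq; rewrite /GRing.scale /=; ring.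
have f1 y : y < s -> dhelmholtz (y - s) = expR (y - s) / 2.
  by move=> ys; rewrite /dhelmholtz /helmholtz ltr0_sg ?ltr0_norm ?subr_lt0// !opprK mul1r.
have f2 y : s < y -> dhelmholtz (y - s) = - (expR (s - y) / 2).
  by move=> ys; rewrite /dhelmholtz /helmholtz gtr0_sg ?gtr0_norm ?subr_gt0// opprB mulN1r.
rewrite (FTC2_split pq mks ki f1 f2 c1 c2 d1 d2); last by rewrite subrr expR0.
have E y : (if y < s then expR (y - s) / 2 else expR (s - y) / 2) = helmholtz (y - s).
  rewrite /helmholtz; case: ifPn => [ys|]; first by rewrite ltr0_norm ?subr_lt0// opprK.
  by rewrite -leNgt => sy; rewrite ger0_norm ?subr_ge0// opprB.
by rewrite !E.
Qed.

End kernels.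

Section resolvent.
Context {R : realType}.
Notation mu := (@lebesgue_measure R).
Notation L1 f := (mu.-integrable [set: R] (EFin \o f)).
Implicit Types k w v : R -> R.

Lemma convol_helmholtz_incr w (p q : R) : L1 (expR_weight w) -> p <= q ->
  convol helmholtz w q - convol helmholtz w p = \int[mu]_(y in `[p, q]) convol dhelmholtz w y.
Proof.
move=> wi pq; rewrite (Rintegral_convol p q measurable_dhelmholtz dhelmholtz_bound wi).2 /convol -RintegralB//; last 2 first.
- exact: L1_convol measurable_helmholtz helmholtz_bound wi.
- exact: L1_convol measurable_helmholtz helmholtz_bound wi.
by apply: eq_Rintegral => s _; rewrite Rintegral_dhelmholtz// mulrBl.
Qed.

Lemma weighted_integrable_itv w (p q : R) : L1 (expR_weight w) -> mu.-integrable `[p, q] (EFin \o w).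
Proof.
move=> wi; have mw := expR_weight_measurable wi.
pose M := expR (Num.max `|p| `|q|).
have H : mu.-integrable `[p, q] (EFin \o (fun y => M * `|expR_weight w y|)).
  by apply: L1_itv; apply: L1Z; exact: integrable_norm.
apply: le_integrable H => //.
  by apply/measurable_EFinP; exact: measurable_funTS.
move=> y /=; rewrite in_itv/= => /andP[py yq]; rewrite lee_fin.
rewrite normrM normr_id (ger0_norm (expR_ge0 _)) normrM mulrA ler_peMl//.
rewrite (ger0_norm (expR_ge0 _)) -expRD -expR0 ler_expR subr_ge0 le_max.
have [y0|y0] := leP 0 y.
  by apply/orP; right; rewrite (ger0_norm y0) (le_trans yq)// ler_norm.
by apply/orP; left; rewrite (ltr0_norm y0) -(normrN p) (le_trans _ (ler_norm (- p)))//; lra.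
Qed.

(** The integrated form of [d_x (dhelmholtz * w) = helmholtz * w - w]: the jump of the
    antiderivative of [helmholtz] reproduces [w]. *)
Lemma convol_dhelmholtz_incr w (p q : R) : L1 (expR_weight w) -> p <= q ->
  convol dhelmholtz w q - convol dhelmholtz w p = \int[mu]_(y in `[p, q]) (convol helmholtz w y - w y).
Proof.
move=> wi pq; have [hi hE] := Rintegral_convol p q measurable_helmholtz helmholtz_bound wi.
have Wi := weighted_integrable_itv p q wi.
have di x := L1_convol x measurable_dhelmholtz dhelmholtz_bound wi.
have mw := expR_weight_measurable wi.
rewrite RintegralB// hE [X in _ = _ - X]Rintegral_mkcond.
have ri : L1 (w \_ `[p, q]).
  have := @integrable_mkcond _ _ _ mu `[p, q] (EFin \o w) (measurable_itv `[p, q]).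
  by case=> /(_ Wi) + _; rewrite restrict_EFin.
have d2i : L1 (fun s => dhelmholtz (q - s) * w s - dhelmholtz (p - s) * w s) by exact: L1B.
rewrite (_ : \int[mu]_s _ = \int[mu]_s ((dhelmholtz (q - s) * w s - dhelmholtz (p - s) * w s) + (w \_ `[p, q]) s)).
  by rewrite RintegralD// addrK RintegralB.
apply/esym/RintegralT_ae_eq.
- exact: L1D.
- apply: measurable_funM mw => //.
  rewrite (_ : (fun _ => _) = fun s => (if q < s then helmholtz (q - s) else 1 - helmholtz (q - s)) -
     (if p < s then helmholtz (p - s) else 1 - helmholtz (p - s))); last first.
    by apply/funext => s; rewrite Rintegral_helmholtz.
  have mif (c : R) : measurable_fun [set: R] (fun s => if c < s then helmholtz (c - s) else 1 - helmholtz (c - s)).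
    have mhc : measurable_fun [set: R] (fun s => helmholtz (c - s)).
      by apply: measurableT_comp measurable_helmholtz _; exact: measurable_funB.
    apply: measurable_fun_ifT => //.
    - exact: measurable_fun_ltr.
    - exact: measurable_funB.
  exact: measurable_funB.
(* off the end points, the two unit jumps differ by the indicator of [p, q] *)
- apply: ae_mono (ae_and (ae_neq p) (ae_neq q)) => s [/eqP sp /eqP sq].
  rewrite Rintegral_helmholtz// patchE mem_setE in_itv/= -[point]/(0 : R).
  have D (c : R) : s != c -> (if c < s then helmholtz (c - s) else 1 - helmholtz (c - s)) = dhelmholtz (c - s) + (s <= c)%R%:R.
    rewrite /dhelmholtz; have [cs|cs|->] := ltgtP c s => // _.
      by rewrite ltr0_sg ?subr_lt0//=; ring.
    by rewrite gtr0_sg ?subr_gt0//= ; ring.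
  rewrite !D//.
  have [sp'|sp'|/eqP] := ltgtP s p; last by rewrite (negbTE sp).
    by rewrite (le_trans (ltW sp') pq) /=; ring.
  by have [sq'|sq'] := leP s q; rewrite /=; ring.
Qed.

Lemma convol_dhelmholtz_continuous w : L1 (expR_weight w) -> continuous (convol dhelmholtz w).
Proof.
move=> wi x; apply: (@incr_continuous _ _ (fun y => convol helmholtz w y - w y) (x - 1) (x + 1)).
- have := integrableB _ (Rintegral_convol (x - 1) (x + 1) measurable_helmholtz helmholtz_bound wi).1 (weighted_integrable_itv (x - 1) (x + 1) wi).
  exact.
- by move=> p q _ pq _; exact: convol_dhelmholtz_incr.
- by apply/andP; split; lra.
Qed.

Lemma convol_helmholtz_derive w (x : R) : L1 (expR_weight w) -> is_derive x 1 (convol helmholtz w) (convol dhelmholtz w x).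
Proof.
move=> wi; apply: (@incr_derive _ _ _ (x - 1) (x + 1)).
- exact: (Rintegral_convol _ _ measurable_dhelmholtz dhelmholtz_bound wi).1.
- by move=> p q _ pq _; exact: convol_helmholtz_incr.
- by apply/andP; split; lra.
- exact: convol_dhelmholtz_continuous.
Qed.

Lemma convol_helmholtz_continuous w : L1 (expR_weight w) -> continuous (convol helmholtz w).
Proof. by move=> wi x; apply: is_derive_continuous; exact: convol_helmholtz_derive. Qed.

Lemma ae_eq_integrable w (g : R -> R) (p q : R) : measurable_fun `[p, q] g ->
  {ae mu, forall y, p <= y <= q -> g y = w y} ->
  mu.-integrable `[p, q] (EFin \o w) ->
  mu.-integrable `[p, q] (EFin \o g) /\
  \int[mu]_(y in `[p, q]) w y = \int[mu]_(y in `[p, q]) g y.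
Proof.
move=> mg gw wi; have mw := measurable_int mu wi.
have mg' : measurable_fun `[p, q] (EFin \o g) by exact/measurable_EFinP.
have ae1 : ae_eq mu `[p, q]%classic (EFin \o w) (EFin \o g).
  by apply: ae_mono gw => y gwy /=; rewrite in_itv/= => /gwy ->.
split; last by rewrite /Rintegral; congr fine; exact: ae_eq_integral.
apply/integrableP; split=> //.
move/integrableP : wi => [_]; rewrite (@ae_eq_integral _ _ _ mu _ (abse \o (EFin \o g)))//.
- exact: measurableT_comp.
- exact: measurableT_comp.
- by apply: ae_mono gw => y gwy /=; rewrite in_itv/= => /gwy ->.
Qed.

(** The operator [w |-> dhelmholtz * w] gains one derivative wherever [w] has a
    continuous representative [g], although [w] is arbitrary elsewhere. This is
    the local smoothing on which the whole proof rests. *)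
Lemma convol_dhelmholtz_derive w (g : R -> R) (c d x : R) : L1 (expR_weight w) -> c < x < d ->
  {ae mu, forall y, c < y < d -> g y = w y} ->
  (forall y, c < y < d -> {for y, continuous g}) ->
  is_derive x 1 (convol dhelmholtz w) (convol helmholtz w x - g x).
Proof.
move=> wi /andP[cx xd] gw cg.
have mg : measurable_fun `]c, d[ g.
  apply: open_continuous_measurable_fun; first exact: interval_open.
  by move=> y; rewrite inE/= in_itv/=; exact: cg.
have sub p q y : (c + x) / 2 <= p -> q <= (x + d) / 2 -> p <= y <= q -> c < y < d.
  by move=> ? ? /andP[? ?]; apply/andP; split; lra.
have gi p q : (c + x) / 2 <= p -> q <= (x + d) / 2 ->
  mu.-integrable `[p, q] (EFin \o g) /\ \int[mu]_(y in `[p, q]) w y = \int[mu]_(y in `[p, q]) g y.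
  move=> hp hq; apply: ae_eq_integrable; last exact: weighted_integrable_itv.
    apply: measurable_funS mg => //.
    by move=> y /=; rewrite !in_itv/=; exact: (sub _ _ _ hp hq).
  by apply: ae_mono gw => y gwy ypq; apply: gwy; exact: (sub _ _ _ hp hq ypq).
have hi p q := (Rintegral_convol p q measurable_helmholtz helmholtz_bound wi).1.
apply: (@incr_derive _ _ (fun y => convol helmholtz w y - g y) ((c + x) / 2) ((x + d) / 2)).
- have := integrableB _ (hi _ _) (gi _ _ (lexx _) (lexx _)).1.
  exact.
- move=> p q hp pq hq; rewrite convol_dhelmholtz_incr// !RintegralB//.
  + by rewrite (gi _ _ hp hq).2.
  + exact: (gi _ _ hp hq).1.
  + exact: weighted_integrable_itv.
- by apply/andP; split; lra.
- apply: continuousB; first exact: convol_helmholtz_continuous.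
  by apply: cg; apply/andP.
Qed.

Definition square_integrable v := measurable_fun [set: R] v /\ L1 (fun x => v x ^+ 2).
Definition bbm_flux v (y : R) : R := v y + v y ^+ 2 / 2.

Lemma bbm_flux_weight_L1 v : square_integrable v -> L1 (expR_weight (bbm_flux v)).
Proof.
move=> [mv vi].
apply: (@L1_le _ _ (fun y => 2^-1 * expR (- `|y|) + v y ^+ 2)).
- apply: measurable_funM.
    by apply: measurableT_comp => //; exact: measurableT_comp.
  by apply: measurable_funD => //; apply: measurable_funM => //; exact: measurable_funX.
- move=> y; rewrite /expR_weight /bbm_flux normrM (ger0_norm (expR_ge0 _)).
  have e1 : expR (- `|y|) <= 1 by rewrite expR_le1 oppr_le0.
  have e0 := expR_ge0 (- `|y|).
  have H : `|v y + v y ^+ 2 / 2| <= 2^-1 + v y ^+ 2 by have := sqr_ge0 (v y - 1); have := sqr_ge0 (v y + 1); have := sqr_ge0 (v y); rewrite ler_norml => *; apply/andP; split; nra.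
  apply: le_trans (ler_wpM2l e0 H) _; rewrite mulrDr mulrC lerD2l.
  by rewrite ler_piMl// sqr_ge0.
- by apply: L1D => //; apply: L1Z; exact: L1_expR_Nnorm.
Qed.

(** The convolution [helmholtz * w] is continuously differentiable for every admissible
    [w], since [dhelmholtz * w] is continuous; hence the classical derivative in
    [bbm_rhs] is everywhere the convolution with [dhelmholtz]. *)
Lemma bbm_rhsE v : square_integrable v -> bbm_rhs v = fun x => - convol dhelmholtz (bbm_flux v) x.
Proof.
move=> vi; apply/funext => x; rewrite /bbm_rhs; congr (- _).
have := convol_helmholtz_derive x (bbm_flux_weight_L1 vi); rewrite derive1E => -[_ <-].
by [].
Qed.

End resolvent.

(** * Dependence of the convolutions on the state *)

Section stability.
Context {R : realType}.
Notation mu := (@lebesgue_measure R).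
Notation L1 f := (mu.-integrable [set: R] (EFin \o f)).
Implicit Types k w v : R -> R.

Lemma square_integrableB v v' : square_integrable v -> square_integrable v' -> square_integrable (fun x => v x - v' x).
Proof.
move=> [mv vi] [mv' vi']; split; first exact: measurable_funB.
apply: (@L1_le _ _ (fun x => 2 * v x ^+ 2 + 2 * v' x ^+ 2)).
- by apply: measurable_funX; exact: measurable_funB.
- move=> x; rewrite ger0_norm ?sqr_ge0//.
  have := sqr_ge0 (v x + v' x); nra.
- by apply: L1D; exact: L1Z.
Qed.

Lemma square_integrable_tri v v' : square_integrable v -> square_integrable v' ->
  \int[mu]_x (v' x ^+ 2) <= 2 * \int[mu]_x (v x ^+ 2) + 2 * \int[mu]_x ((v' x - v x) ^+ 2).
Proof.
move=> iv iv'; have [_ di] := square_integrableB iv' iv.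
have [mv vi] := iv; have [mv' vi'] := iv'.
rewrite -!RintegralZl// -RintegralD//; last 2 first.
- exact: L1Z.
- exact: L1Z.
apply: RintegralT_le => //; first by apply: L1D; exact: L1Z.
move=> x; have := sqr_ge0 (v' x - 2 * v x); nra.
Qed.

(** Young's inequality with a free parameter [e] replaces Cauchy-Schwarz; the
    right-hand side is small as soon as [e] is small and the L^2 distance of [v]
    and [v'] is small compared with [e]. *)
Lemma bbm_flux_dist v v' (e : R) : square_integrable v -> square_integrable v' -> 0 < e ->
  \int[mu]_y `|expR_weight (fun y => bbm_flux v' y - bbm_flux v y) y| <=
  e * (\int[mu]_y expR (- `|y|) + \int[mu]_y (v y ^+ 2) + \int[mu]_y (v' y ^+ 2)) +
  e^-1 * \int[mu]_y ((v' y - v y) ^+ 2).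
Proof.
move=> iv iv' e0; have [_ di] := square_integrableB iv' iv.
have [mv vi] := iv; have [mv' vi'] := iv'.
have i1 : L1 (fun y => expR (- `|y|) + v y ^+ 2) by apply: L1D => //; exact: L1_expR_Nnorm.
have i2 : L1 (fun y => expR (- `|y|) + v y ^+ 2 + v' y ^+ 2) by exact: L1D.
rewrite -RintegralD//; last exact: L1_expR_Nnorm.
rewrite -RintegralD// -!RintegralZl// -RintegralD//; last 2 first.
- exact: L1Z.
- exact: L1Z.
apply: RintegralT_le.
- apply: integrable_norm.
  apply: (@L1_eq _ (fun y => expR_weight (bbm_flux v') y - expR_weight (bbm_flux v) y)).
    by move=> y; rewrite /expR_weight mulrBr.
  by apply: L1B; exact: bbm_flux_weight_L1.
- by apply: L1D; exact: L1Z.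
move=> y; rewrite /expR_weight /bbm_flux normrM (ger0_norm (expR_ge0 _)).
set E := expR _; set a := v y; set b := v' y.
have E0 : 0 <= E by exact: expR_ge0.
have E1 : E <= 1 by rewrite expR_le1 oppr_le0.
rewrite (_ : b + b ^+ 2 / 2 - (a + a ^+ 2 / 2) = (b - a) * (1 + (b + a) / 2)); last by ring.
set d := b - a.
set q := e^-1 * d ^+ 2.
have ei : e * e^-1 = 1 by rewrite divff ?gt_eqF.
have ei0 : 0 < e^-1 by rewrite invr_gt0.
have q0 : 0 <= q by rewrite mulr_ge0 ?sqr_ge0// ltW.
have Y (c : R) : `|d * c| <= (e * c ^+ 2 + q) / 2.
  have H1 := mulr_ge0 (ltW ei0) (sqr_ge0 (e * c - d)).
  have H2 := mulr_ge0 (ltW ei0) (sqr_ge0 (e * c + d)).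
  have X1 : e^-1 * (e * c - d) ^+ 2 = (e * e^-1) * e * c ^+ 2 - 2 * (e * e^-1) * (d * c) + q by rewrite /q; ring.
  have X2 : e^-1 * (e * c + d) ^+ 2 = (e * e^-1) * e * c ^+ 2 + 2 * (e * e^-1) * (d * c) + q by rewrite /q; ring.
  rewrite X1 ei in H1; rewrite X2 ei in H2.
  by rewrite ler_norml; apply/andP; split; lra.
have -> : d * (1 + (b + a) / 2) = d * 1 + d * (b + a) / 2 by ring.
have Y1 : E * `|d * 1| <= E * e / 2 + q / 2.
  apply: le_trans (ler_wpM2l E0 (Y 1)) _; nra.
have Y2 : E * `|d * (b + a) / 2| <= (e * (b + a) ^+ 2 + q) / 4.
  rewrite normrM (ger0_norm (_ : 0 <= 2^-1)) ?invr_ge0// mulrA.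
  have := Y (b + a); have := normr_ge0 (d * (b + a)).
  set n := `| _ |; nra.
apply: le_trans (ler_wpM2l E0 (ler_normD _ _)) _.
rewrite mulrDr (le_trans (lerD Y1 Y2))//.
have : e * (b + a) ^+ 2 <= e * (2 * a ^+ 2 + 2 * b ^+ 2).
  apply: ler_wpM2l; [exact: ltW|have := sqr_ge0 (b - a); nra].
have : 0 <= e * a ^+ 2 by rewrite mulr_ge0 ?sqr_ge0// ltW.
have : 0 <= e * b ^+ 2 by rewrite mulr_ge0 ?sqr_ge0// ltW.
have : 0 <= E * e by rewrite mulr_ge0// ltW.
lra.
Qed.

Lemma convol_flux_dist k v v' (e x : R) : measurable_fun [set: R] k ->
  (forall z, `|k z| <= expR (- `|z|)) -> square_integrable v -> square_integrable v' -> 0 < e ->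
  `|convol k (bbm_flux v') x - convol k (bbm_flux v) x| <=
  expR `|x| * (e * (\int[mu]_y expR (- `|y|) + \int[mu]_y (v y ^+ 2) + \int[mu]_y (v' y ^+ 2)) +
  e^-1 * \int[mu]_y ((v' y - v y) ^+ 2)).
Proof.
move=> mk kb iv iv' e0.
have i1 := L1_convol x mk kb (bbm_flux_weight_L1 iv).
have i2 := L1_convol x mk kb (bbm_flux_weight_L1 iv').
have ii : L1 (expR_weight (fun y => bbm_flux v' y - bbm_flux v y)).
  apply: (@L1_eq _ (fun y => expR_weight (bbm_flux v') y - expR_weight (bbm_flux v) y)).
    by move=> y; rewrite /expR_weight mulrBr.
  by apply: L1B; exact: bbm_flux_weight_L1.
have -> : convol k (bbm_flux v') x - convol k (bbm_flux v) x = convol k (fun y => bbm_flux v' y - bbm_flux v y) x.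
  by rewrite /convol -RintegralB//; apply: eq_Rintegral => y _; rewrite mulrBr.
apply: le_trans (convol_bound x mk kb ii) _.
by rewrite ler_wpM2l ?expR_ge0//; exact: bbm_flux_dist.
Qed.

Lemma convol_flux_continuous k v (B e : R) : measurable_fun [set: R] k ->
  (forall z, `|k z| <= expR (- `|z|)) -> square_integrable v -> 0 < e ->
  exists2 d, 0 < d & forall v', square_integrable v' -> \int[mu]_y ((v' y - v y) ^+ 2) <= d ->
    forall x, `|x| <= B -> `|convol k (bbm_flux v') x - convol k (bbm_flux v) x| <= e.
Proof.
move=> mk kb iv e0.
set E := \int[mu]_y expR (- `|y|); set N := \int[mu]_y (v y ^+ 2).
have E0 : 0 <= E by apply: Rintegral_ge0 => y _; exact: expR_ge0.
have N0 : 0 <= N by apply: Rintegral_ge0 => y _; exact: sqr_ge0.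
pose K := E + 3 * N + 2.
have K0 : 0 < K by rewrite /K; lra.
have b0 : 0 < expR B by exact: expR_gt0.
(* [h] is the parameter of Young's inequality, chosen so that each of the
   two terms is at most [f]; [K] bounds the masses for [v'] at distance 1 *)
pose f := e / (2 * expR B).
have f0 : 0 < f by rewrite divr_gt0// mulr_gt0.
pose h := f / K; have h0 : 0 < h by rewrite divr_gt0.
exists (Num.min 1 (h * f)); first by rewrite lt_min ltr01 mulr_gt0.
move=> v' iv'; rewrite le_min => /andP[D1 D2] x xB.
apply: le_trans (convol_flux_dist x mk kb iv iv' h0) _.
rewrite -/E -/N; set D := \int[mu]_y ((v' y - v y) ^+ 2) in D1 D2 *.
have H1 : h * (E + N + \int[mu]_y (v' y ^+ 2)) <= f.
  rewrite /h mulrAC ler_pdivrMr// ler_wpM2l ?(ltW f0)//.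
  have := square_integrable_tri iv iv'; rewrite -/N -/D /K; lra.
have H2 : h^-1 * D <= f by rewrite mulrC ler_pdivrMr// mulrC.
have : expR `|x| <= expR B by rewrite ler_expR.
have -> : e = expR B * (f + f) by rewrite /f; field; rewrite gt_eqF.
move=> xb; apply: ler_pM => //.
  apply: addr_ge0; apply: mulr_ge0.
  - exact: ltW.
  - by rewrite addr_ge0 ?addr_ge0//; apply: Rintegral_ge0 => y _; exact: sqr_ge0.
  - by rewrite invr_ge0 ltW.
  - by apply: Rintegral_ge0 => y _; exact: sqr_ge0.
exact: lerD.
Qed.

Lemma convol_flux_bound k v (x : R) : measurable_fun [set: R] k ->
  (forall z, `|k z| <= expR (- `|z|)) -> square_integrable v ->
  `|convol k (bbm_flux v) x| <= expR `|x| * (\int[mu]_y expR (- `|y|) + \int[mu]_y (v y ^+ 2)).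
Proof.
move=> mk kb iv; apply: le_trans (convol_bound x mk kb (bbm_flux_weight_L1 iv)) _.
rewrite ler_wpM2l ?expR_ge0// -RintegralD//; last 2 first.
- exact: L1_expR_Nnorm.
- by case: iv.
apply: RintegralT_le.
- by apply: integrable_norm; exact: bbm_flux_weight_L1.
- by apply: L1D; [exact: L1_expR_Nnorm|case: iv].
move=> y; rewrite /expR_weight /bbm_flux normrM (ger0_norm (expR_ge0 _)).
have e1 : expR (- `|y|) <= 1 by rewrite expR_le1 oppr_le0.
have e0 := expR_ge0 (- `|y|).
have H : `|v y + v y ^+ 2 / 2| <= 2^-1 + v y ^+ 2.
  by have := sqr_ge0 (v y - 1); have := sqr_ge0 (v y + 1); have := sqr_ge0 (v y); rewrite ler_norml => *; apply/andP; split; nra.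
apply: le_trans (ler_wpM2l e0 H) _; rewrite mulrDr lerD//; first by rewrite ler_piMr//; lra.
by rewrite ler_piMl// sqr_ge0.
Qed.

End stability.

(** * The Poisson kernel and a regularised Parseval formula *)

Section poisson.
Context {R : realType}.
Notation mu := (@lebesgue_measure R).
Notation L1 f := (mu.-integrable [set: R] (EFin \o f)).

Lemma measurable_kernel_integral (b : R -> R) (m : R -> R -> R) (M : R) : L1 b ->
  measurable_fun [set: R * R] (fun z => m z.1 z.2) -> (forall x y, `|m x y| <= M) ->
  measurable_fun [set: R] (fun x => \int[mu]_y (m x y * b y)).
Proof.
move=> bi mm mM; have /L1_measurable H := (Fubini_bounded_kernel L1_expR_Nnorm bi mm mM).1.
rewrite (_ : (fun x => _) = (fun x => expR `|x| * (expR (- `|x|) * \int[mu]_y (m x y * b y)))).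
  apply: measurable_funM => //; exact: measurableT_comp.
by apply/funext => x; rewrite mulrA -expRD subrr expR0 mul1r.
Qed.

(** Up to the factor [pi], the Poisson kernel of the half-plane at height [e]. *)
Definition poisson (e z : R) : R := e / (e ^+ 2 + z ^+ 2).
Definition half_exp (e : R) : R -> R := fun xi => \1_(`[0, +oo[) xi * expR (- (e * xi)).

Lemma is_derive_expRZ (e x : R) : is_derive x 1 (fun y : R => expR (- (e * y))) (- e * expR (- (e * x))).
Proof. by apply: is_derive_eq; rewrite /GRing.scale /=; ring. Qed.

Lemma half_expE (e xi : R) : half_exp e xi = if 0 <= xi then expR (- (e * xi)) else 0.
Proof.
by rewrite /half_exp indicE mem_setE in_itv/= andbT; case: (0 <= xi); rewrite ?mul1r ?mul0r.
Qed.

Lemma measurable_half_exp e : measurable_fun [set: R] (half_exp e).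
Proof.
apply: measurable_funM; first exact: measurable_indic.
apply: continuous_measurable_fun => x.
exact: (is_derive_continuous (is_derive_expRZ e x)).
Qed.

Lemma half_exp_ge0 (e xi : R) : 0 <= half_exp e xi.
Proof. by rewrite half_expE; case: ifP => // _; exact: expR_ge0. Qed.

Lemma half_exp_le1 (e xi : R) : 0 < e -> half_exp e xi <= 1.
Proof.
move=> e0; rewrite half_expE; case: ifP => // x0.
by rewrite expR_le1 oppr_le0 mulr_ge0// ltW.
Qed.

Lemma cvg_expRNZ (e : R) : 0 < e -> expR (- (e * x)) @[x --> +oo] --> (0 : R).
Proof.
move=> e0; apply: (cvg_comp (fun x : R => e * x) (fun y => expR (- y))); last exact: cvgr_expR.
by apply: gt0_cvgMry => //; exact: cvg_id.
Qed.

Lemma L1_half_exp (e : R) : 0 < e -> L1 (half_exp e).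
Proof.
move=> e0; apply/integrableP; split.
  by apply/measurable_EFinP; exact: measurable_half_exp.
have cf : continuous (fun y : R => expR (- (e * y))).
  by move=> y; exact: (is_derive_continuous (is_derive_expRZ e y)).
have dF (x : R) : is_derive x 1 (fun y : R => - e^-1 * expR (- (e * y))) (expR (- (e * x))).
  apply: is_derive_eq; rewrite /GRing.scale /=; field; exact: lt0r_neq0.
have f0 (x : R) : 0 <= x -> 0 <= expR (- (e * x)) by move=> _; exact: expR_ge0.
have Fl : - e^-1 * expR (- (e * x)) @[x --> +oo] --> (- e^-1 * 0 : R).
  by apply: cvgM; [exact: cvg_cst|exact: cvg_expRNZ].
have E := FTC2y_global f0 cf dF Fl.
rewrite (_ : (\int[mu]_x _)%E = (\int[mu]_(x in `[0%R, +oo[) (expR (- (e * x)))%:E)%E).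
  by rewrite E ltry.
rewrite [RHS]integral_mkcond; apply: eq_integral => y _ /=.
rewrite ger0_norm ?half_exp_ge0// half_expE patchE mem_setE in_itv/= andbT.
by case: ifP.
Qed.

(** The Poisson kernel is the cosine transform of a decaying exponential. The
    antiderivative of [cos (z * x) * expR (- (e * x))] is explicit, and its
    boundary term at [n] tends to [0]. *)
Lemma cosine_transform_half_exp (e z : R) : 0 < e ->
  \int[mu]_xi (cos (z * xi) * half_exp e xi) = poisson e z.
Proof.
move=> e0.
pose F (x : R) := (e ^+ 2 + z ^+ 2)^-1 * (expR (- (e * x)) * (z * sin (z * x) - e * cos (z * x))).
have dn0 : e ^+ 2 + z ^+ 2 != 0.
  by rewrite gt_eqF// ltr_pwDl ?sqr_ge0// exprn_gt0.
have dF (x : R) : is_derive x 1 F (expR (- (e * x)) * cos (z * x)).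
  apply: is_derive_eq; rewrite /GRing.scale /=; field; exact: dn0.
have cf : continuous (fun x : R => expR (- (e * x)) * cos (z * x)).
  by move=> y; apply: is_derive_continuous.
have En (n : nat) : \int[mu]_xi (\1_(`[0, n%:R]) xi * (cos (z * xi) * half_exp e xi)) = F n%:R - F 0.
  rewrite -(FTC2_global _ cf dF)// [RHS]Rintegral_mkcond.
  apply: eq_Rintegral => x _; rewrite patchE indicE mem_setE half_expE in_itv/=.
  by have [x0|x0] := leP 0 x; case: (x <= n%:R); rewrite /= ?mul0r ?mul1r// mulrC.
have mg : measurable_fun [set: R] (fun xi => cos (z * xi) * half_exp e xi).
  apply: measurable_funM; last exact: measurable_half_exp.
  apply: continuous_measurable_fun => y; apply: is_derive_continuous.
have [_ cv] : L1 (fun xi => cos (z * xi) * half_exp e xi) /\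
  \int[mu]_xi (\1_(`[0, n%:R]) xi * (cos (z * xi) * half_exp e xi)) @[n --> \oo] -->
  \int[mu]_xi (cos (z * xi) * half_exp e xi).
  apply: (@RintegralT_dominated_cvg _ _ _ (half_exp e)) => //.
  - by move=> n; apply: measurable_funM => //; exact: measurable_indic.
  - exact: L1_half_exp.
  - apply: ae_all => x.
    apply: cvg_near_cst; near=> n.
    rewrite indicE mem_setE in_itv/= half_expE; have [x0|x0] := leP 0 x; last by rewrite mul0r mulr0.
    rewrite (_ : x <= n%:R) ?mul1r//.
    near: n; exact: nbhs_infty_ger.
  - move=> n x; rewrite normrM -[leRHS]mul1r ler_pM//.
      by rewrite indicE; case: (_ \in _); rewrite /= ?normr1 ?normr0.
    rewrite normrM (ger0_norm (half_exp_ge0 _ _)) ler_piMl ?half_exp_ge0//.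
    by rewrite ler_norml cos_geN1 cos_le1.
have Fl : F n%:R @[n --> \oo] --> (0 : R).
  apply: norm_cvg0.
  pose C := (e ^+ 2 + z ^+ 2)^-1 * (`|z| + e).
  have H : C * expR (- (e * n%:R)) @[n --> \oo] --> C * 0.
    apply: cvgM; first exact: cvg_cst.
    by apply: (cvg_comp (fun n : nat => n%:R : R) (fun x => expR (- (e * x)))); [exact: cvgr_idn|exact: cvg_expRNZ].
  rewrite mulr0 in H.
  apply: (squeeze_cvgr _ (cvg_cst 0) H); apply: nearW => n.
  rewrite normr_ge0/= /F normrM /C -mulrA ger0_norm ?invr_ge0 ?addr_ge0 ?sqr_ge0//.
  rewrite ler_wpM2l ?invr_ge0 ?addr_ge0 ?sqr_ge0// normrM (ger0_norm (expR_ge0 _)).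
  rewrite mulrC ler_wpM2r ?expR_ge0// (le_trans (ler_normB _ _))// lerD//.
    by rewrite normrM ler_piMr// ler_norml sin_geN1 sin_le1.
  by rewrite normrM (gtr0_norm e0) ler_piMr ?(ltW e0)// ler_norml cos_geN1 cos_le1.
have cv2 : F n%:R - F 0 @[n --> \oo] --> 0 - F 0.
  by apply: cvgB => //; exact: cvg_cst.
rewrite (_ : (fun n => _) = (fun n : nat => F n%:R - F 0)) in cv; last by apply/funext.
rewrite -(cvg_lim _ cv)// (cvg_lim _ cv2)//.
rewrite /F /poisson !mulr0 sin0 cos0 oppr0 expR0; field; exact: dn0.
Unshelve. all: end_near. Qed.

End poisson.

Section parseval.
Context {R : realType}.
Notation mu := (@lebesgue_measure R).
Notation L1 f := (mu.-integrable [set: R] (EFin \o f)).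
Implicit Types h p : R -> R.

Definition fourier_cos h (xi : R) := \int[mu]_x (cos (x * xi) * h x).
Definition fourier_sin h (xi : R) := \int[mu]_x (sin (x * xi) * h x).

Lemma measurable_cosM : measurable_fun [set: R * R] (fun z : R * R => cos (z.1 * z.2)).
Proof.
apply: (@measurableT_comp _ _ _ _ _ _ (@cos R)).
  by apply: continuous_measurable_fun; exact: continuous_cos.
by apply: measurable_funM; [exact: measurable_fst|exact: measurable_snd].
Qed.

Lemma measurable_sinM : measurable_fun [set: R * R] (fun z : R * R => sin (z.1 * z.2)).
Proof.
apply: (@measurableT_comp _ _ _ _ _ _ (@sin R)).
  by apply: continuous_measurable_fun; exact: continuous_sin.
by apply: measurable_funM; [exact: measurable_fst|exact: measurable_snd].
Qed.

Lemma measurable_swap (m : R -> R -> R) : measurable_fun [set: R * R] (fun z => m z.1 z.2) ->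
  measurable_fun [set: R * R] (fun z => m z.2 z.1).
Proof.
move=> mm; exact: (measurableT_comp mm (measurable_fun_pair measurable_snd measurable_fst)).
Qed.

Lemma normr_cos (x : R) : `|cos x| <= 1.
Proof. by rewrite ler_norml cos_geN1 cos_le1. Qed.

Lemma normr_sin (x : R) : `|sin x| <= 1.
Proof. by rewrite ler_norml sin_geN1 sin_le1. Qed.

Lemma L1_cos h xi : L1 h -> L1 (fun x => cos (x * xi) * h x).
Proof.
move=> hi; apply: (L1M (M := 1) hi); last by move=> x; exact: normr_cos.
exact: (@measurable_slice _ (fun xi x => cos (x * xi)) xi (measurable_swap (m := fun x xi => cos (x * xi)) measurable_cosM)).
Qed.

Lemma L1_sin h xi : L1 h -> L1 (fun x => sin (x * xi) * h x).
Proof.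
move=> hi; apply: (L1M (M := 1) hi); last by move=> x; exact: normr_sin.
exact: (@measurable_slice _ (fun xi x => sin (x * xi)) xi (measurable_swap (m := fun x xi => sin (x * xi)) measurable_sinM)).
Qed.

Lemma measurable_fourier_cos h : L1 h -> measurable_fun [set: R] (fourier_cos h).
Proof.
move=> hi; apply: (measurable_kernel_integral (M := 1) hi (m := fun xi x => cos (x * xi))).
  exact: (measurable_swap (m := fun x xi => cos (x * xi)) measurable_cosM).
by move=> xi x; exact: normr_cos.
Qed.

Lemma measurable_fourier_sin h : L1 h -> measurable_fun [set: R] (fourier_sin h).
Proof.
move=> hi; apply: (measurable_kernel_integral (M := 1) hi (m := fun xi x => sin (x * xi))).
  exact: (measurable_swap (m := fun x xi => sin (x * xi)) measurable_sinM).
by move=> xi x; exact: normr_sin.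
Qed.

Lemma fourier_cos_bound h xi : L1 h -> `|fourier_cos h xi| <= \int[mu]_x `|h x|.
Proof.
move=> hi; apply: RintegralT_norm_le; [exact: L1_cos|exact: integrable_norm|].
by move=> x; rewrite normrM ler_piMl// normr_cos.
Qed.

Lemma fourier_sin_bound h xi : L1 h -> `|fourier_sin h xi| <= \int[mu]_x `|h x|.
Proof.
move=> hi; apply: RintegralT_norm_le; [exact: L1_sin|exact: integrable_norm|].
by move=> x; rewrite normrM ler_piMl// normr_sin.
Qed.

(** Parseval's formula regularised by the Abel factor [expR (- e xi)] on the
    half-line: the factor makes all the integrals converge absolutely, and two
    applications of Fubini bring out the Poisson kernel. *)
Lemma poisson_parseval (e : R) h p : 0 < e -> L1 h -> L1 p ->
  \int[mu]_xi (half_exp e xi * (fourier_cos h xi * fourier_cos p xi + fourier_sin h xi * fourier_sin p xi)) =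
  \int[mu]_x (h x * \int[mu]_y (poisson e (x - y) * p y)).
Proof.
move=> e0 hi pi.
have ai := L1_half_exp e0.
pose m1 xi x := cos (x * xi) * fourier_cos p xi + sin (x * xi) * fourier_sin p xi.
pose M := \int[mu]_x `|p x|.
have mm1 : measurable_fun [set: R * R] (fun z => m1 z.1 z.2).
  apply: measurable_funD; apply: measurable_funM.
  - exact: (measurable_swap (m := fun x xi => cos (x * xi)) measurable_cosM).
  - by apply: measurableT_comp; [exact: measurable_fourier_cos|exact: measurable_fst].
  - exact: (measurable_swap (m := fun x xi => sin (x * xi)) measurable_sinM).
  - by apply: measurableT_comp; [exact: measurable_fourier_sin|exact: measurable_fst].
have m1M xi x : `|m1 xi x| <= M + M.
  rewrite (le_trans (ler_normD _ _))// !normrM -[X in _ <= X + _]mul1r -[X in _ <= _ + X]mul1r.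
  by rewrite lerD// ler_pM// ?normr_cos ?normr_sin ?fourier_cos_bound ?fourier_sin_bound.
have [_ E1] := Fubini_bounded_kernel ai hi mm1 m1M.
transitivity (\int[mu]_xi (half_exp e xi * \int[mu]_x (m1 xi x * h x))).
  apply: eq_Rintegral => xi _; congr (_ * _).
  rewrite mulrC (mulrC (fourier_sin h xi)) /fourier_cos /fourier_sin.
  rewrite -(RintegralZl _ measurableT (L1_cos xi hi)) -(RintegralZl _ measurableT (L1_sin xi hi)).
  rewrite -(RintegralD measurableT (L1Z _ (L1_cos xi hi)) (L1Z _ (L1_sin xi hi))).
  by apply: eq_Rintegral => x _; rewrite /m1 /fourier_cos /fourier_sin; ring.
rewrite E1; apply: eq_Rintegral => x _; congr (_ * _).
pose m2 xi y := cos ((x - y) * xi).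
have mm2 : measurable_fun [set: R * R] (fun z => m2 z.1 z.2).
  apply: (@measurableT_comp _ _ _ _ _ _ (@cos R)).
    by apply: continuous_measurable_fun; exact: continuous_cos.
  apply: measurable_funM; last exact: measurable_fst.
  by apply: measurable_funB => //; exact: measurable_snd.
have [_ E2] := Fubini_bounded_kernel ai pi mm2 (fun xi y => normr_cos ((x - y) * xi)).
transitivity (\int[mu]_xi (half_exp e xi * \int[mu]_y (m2 xi y * p y))).
  apply: eq_Rintegral => xi _; rewrite mulrC; congr (_ * _).
  rewrite /m1 /fourier_cos /fourier_sin.
  rewrite -(RintegralZl _ measurableT (L1_cos xi pi)) -(RintegralZl _ measurableT (L1_sin xi pi)).
  rewrite -(RintegralD measurableT (L1Z _ (L1_cos xi pi)) (L1Z _ (L1_sin xi pi))).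
  apply: eq_Rintegral => y _; rewrite /m2 mulrBl cosB; ring.
rewrite E2; apply: eq_Rintegral => y _.
by rewrite mulrC -cosine_transform_half_exp.
Qed.

(** The regularised Parseval form is positive, whence
    [2 E(h, p) <= E(h, h) + E(p, p)]; and [E(h, h)] is at most the integral over
    the whole line without the Abel factor. *)
Lemma poisson_energy_le (e : R) h p : 0 < e -> L1 h -> L1 p ->
  L1 (fun xi => fourier_cos h xi ^+ 2 + fourier_sin h xi ^+ 2) ->
  2 * \int[mu]_x (h x * \int[mu]_y (poisson e (x - y) * p y)) <=
  \int[mu]_xi (fourier_cos h xi ^+ 2 + fourier_sin h xi ^+ 2) +
  \int[mu]_x (p x * \int[mu]_y (poisson e (x - y) * p y)).
Proof.
move=> e0 hi pi Ni.
rewrite -(poisson_parseval e0 hi pi) -(poisson_parseval e0 pi pi).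
have ai := L1_half_exp e0.
have Li f g : L1 f -> L1 g -> L1 (fun xi => half_exp e xi * (fourier_cos f xi * fourier_cos g xi + fourier_sin f xi * fourier_sin g xi)).
  move=> fi gi.
  apply: (@L1_eq _ (fun xi => (fourier_cos f xi * fourier_cos g xi + fourier_sin f xi * fourier_sin g xi) * half_exp e xi)).
    by move=> xi; rewrite mulrC.
  pose F := \int[mu]_x `|f x|; pose G := \int[mu]_x `|g x|.
  apply: (L1M (M := F * G + F * G)) => //.
    apply: measurable_funD; apply: measurable_funM.
    - exact: (measurable_fourier_cos fi).
    - exact: (measurable_fourier_cos gi).
    - exact: (measurable_fourier_sin fi).
    - exact: (measurable_fourier_sin gi).
  move=> xi; rewrite (le_trans (ler_normD _ _))// !normrM.
  by rewrite lerD// ler_pM// ?fourier_cos_bound ?fourier_sin_bound.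
rewrite -RintegralZl//; last exact: Li.
rewrite -RintegralD//; last exact: Li.
apply: RintegralT_le.
- by apply: L1Z; exact: Li.
- by apply: L1D => //; exact: Li.
move=> xi; have a0 := half_exp_ge0 e xi; have a1 := half_exp_le1 xi e0.
set a := half_exp e xi in a0 a1 *; set C := fourier_cos h xi; set S := fourier_sin h xi; set D := fourier_cos p xi; set T := fourier_sin p xi.
have H1 : 0 <= a * ((C - D) ^+ 2 + (S - T) ^+ 2) by rewrite mulr_ge0// addr_ge0// sqr_ge0.
have H2 : 0 <= (1 - a) * (C ^+ 2 + S ^+ 2) by rewrite mulr_ge0 ?subr_ge0// addr_ge0// sqr_ge0.
rewrite -!expr2; nra.
Qed.

End parseval.

Section poisson_mass.
Context {R : realType}.
Notation mu := (@lebesgue_measure R).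
Notation L1 f := (mu.-integrable [set: R] (EFin \o f)).
Implicit Types h p : R -> R.

Lemma poisson_gt0 (e z : R) : 0 < e -> 0 < poisson e z.
Proof. by move=> e0; rewrite divr_gt0// ltr_pwDl ?sqr_ge0// exprn_gt0. Qed.

Lemma is_derive_atan_poisson (e x y : R) : 0 < e ->
  is_derive y 1 (fun y => atan (e^-1 * (y - x))) (poisson e (x - y)).
Proof.
move=> e0; apply: is_derive_eq; rewrite /GRing.scale /= /poisson.
have n1 : e != 0 by rewrite gt_eqF.
have n2 : e ^+ 2 + (x - y) ^+ 2 != 0 by rewrite gt_eqF// ltr_pwDl ?sqr_ge0// exprn_gt0.
by field; rewrite n1 n2.
Qed.

Lemma continuous_poisson (e x : R) : 0 < e -> continuous (fun y => poisson e (x - y)).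
Proof.
move=> e0 y; apply: is_derive_continuous.
have n2 : e ^+ 2 + (x - y) ^+ 2 != 0 by rewrite gt_eqF// ltr_pwDl ?sqr_ge0// exprn_gt0.
apply: is_deriveM; apply: is_deriveV => //.
Qed.

Lemma Rintegral_poisson (e x : R) : 0 < e ->
  L1 (fun y => poisson e (x - y)) /\ \int[mu]_y (poisson e (x - y)) = pi.
Proof.
move=> e0.
have cp := @continuous_poisson e x e0.
have mp := continuous_measurable_fun cp.
have ei : 0 < e^-1 by rewrite invr_gt0.
have right c : (\int[mu]_(y in `[c, +oo[) (poisson e (c - y))%:E = (pi / 2)%:E)%E.
  have f0 y : c <= y -> 0 <= poisson e (c - y) by move=> _; rewrite ltW// poisson_gt0.
  have Fl : atan (e^-1 * (y - c)) @[y --> +oo] --> pi / 2.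
    apply: (cvg_comp (fun y : R => e^-1 * (y - c)) (@atan R)); last exact: cvgy_atan.
    by apply: gt0_cvgMry => //; exact: cvg_addrr.
  have := FTC2y_global f0 (@continuous_poisson e c e0) (fun y => @is_derive_atan_poisson e c y e0) Fl.
  by rewrite subrr mulr0 atan0 sube0.
have left : (\int[mu]_(y in `]-oo, x]) (poisson e (x - y))%:E = (pi / 2)%:E)%E.
  rewrite -[X in `]-oo, X]](opprK x) ge0_integration_by_substitutionNy.
  - by rewrite -(right (- x)); apply: eq_integral => y _ /=; rewrite /poisson; congr (EFin (_ / (_ + _))); ring.
  - exact: continuous_subspaceT.
  - by move=> y _; rewrite ltW// poisson_gt0.
have E : (\int[mu]_y (poisson e (x - y))%:E = pi%:E)%E.
  rewrite -(setUv `]-oo, x]%classic) setCitvl/= ge0_integral_setU//=.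
  - rewrite left integral_itv_obnd_cbnd ?right -?EFinD; first by congr EFin; lra.
    by apply/measurable_EFinP; exact: measurable_funTS.
  - by apply/measurable_EFinP; exact: measurable_funTS.
  - by move=> y _; rewrite lee_fin ltW// poisson_gt0.
  - by apply/disj_setPS => y [/=]; rewrite !in_itv/= andbT => yx; rewrite ltNge yx.
split; last by rewrite /Rintegral E.
apply/integrableP; split; first exact/measurable_EFinP.
under eq_integral do rewrite gee0_abs ?lee_fin ?(ltW (poisson_gt0 _ e0))//.
by rewrite E ltry.
Qed.

End poisson_mass.

Section poisson_limit.
Context {R : realType}.
Notation mu := (@lebesgue_measure R).
Notation L1 f := (mu.-integrable [set: R] (EFin \o f)).
Implicit Types h p : R -> R.

(** A bound of the Poisson kernel times the increment of a bounded Lipschitz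
    function that is uniform in [e <= 1]: near the origin one uses
    [2 e r <= e^2 + r^2], and away from it [2 r^2 >= 1 + r^2]. *)
Lemma poisson_increment_dom (e z L M d : R) : 0 < e <= 1 -> 0 <= L -> `|d| <= L * `|z| -> `|d| <= M ->
  `|poisson e z * d| <= (L + 2 * M) * poisson 1 z.
Proof.
move=> /andP[e0 e1] L0 dL dM.
rewrite normrM (ger0_norm (ltW (poisson_gt0 z e0))) /poisson expr1n.
set n := `|d| in dL dM *; have n0 : 0 <= n by exact: normr_ge0.
have z2 : 0 <= z ^+ 2 by exact: sqr_ge0.
have E2 : 0 < e ^+ 2 by rewrite exprn_gt0.
have D1 : 0 < e ^+ 2 + z ^+ 2 by lra.
have D2 : 0 < 1 + z ^+ 2 by lra.
rewrite mulrAC ler_pdivrMr// mulrA mulr1 mulrAC ler_pdivlMr//.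
set r := `|z| in dL *.
have r0 : 0 <= r by exact: normr_ge0.
have zr : z ^+ 2 = r ^+ 2 by rewrite real_normK// num_real.
rewrite zr.
have P1 : 0 <= e * n by rewrite mulr_ge0// ltW.
have P2 : 0 <= 1 + r ^+ 2 by rewrite addr_ge0// sqr_ge0.
have [r1|r1] := leP r 1.
  have : e * n * (1 + r ^+ 2) <= L * (e * r) * 2.
    have : e * n <= L * (e * r) by rewrite mulrCA ler_wpM2l// ltW.
    have : r ^+ 2 <= 1 by rewrite expr_le1.
    move=> H1 H2; apply: (ler_pM P1 P2 H2); lra.
  have : L * (e * r) * 2 <= L * (e ^+ 2 + r ^+ 2).
    have := sqr_ge0 (e - r); rewrite -mulrA => H; apply: ler_wpM2l => //; nra.
  have : 0 <= M * (e ^+ 2 + r ^+ 2) by apply: mulr_ge0; [exact: le_trans dM|rewrite -zr ltW].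
  lra.
have M0 : 0 <= M by lra.
have : e * n * (1 + r ^+ 2) <= M * (2 * r ^+ 2).
  apply: (ler_pM P1 P2); nra.
have : 0 <= L * (e ^+ 2 + r ^+ 2) by rewrite mulr_ge0// -zr ltW.
have : 0 <= M * e ^+ 2 by rewrite mulr_ge0// ltW.
lra.
Qed.


Definition lipschitz_bounded (p : R -> R) (L M : R) :=
  (forall x, `|p x| <= M) /\ (forall x y, `|p y - p x| <= L * `|x - y|).

Lemma poisson_le (e z : R) : 0 < e -> poisson e z <= e^-1.
Proof.
move=> e0; have E2 : 0 < e ^+ 2 by rewrite exprn_gt0.
rewrite /poisson ler_pdivrMr; last by rewrite ltr_pwDl// sqr_ge0.
by rewrite mulrDr expr2 mulKf ?gt_eqF// lerDl mulr_ge0 ?sqr_ge0// invr_ge0 ltW.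
Qed.

(** An approximation of the identity: the total mass is [pi] for every height,
    and the increments of [p] are dominated uniformly. *)
Lemma poisson_convol_cvg p (L M x : R) : measurable_fun [set: R] p -> 0 <= L ->
  lipschitz_bounded p L M ->
  \int[mu]_y (poisson n.+1%:R^-1 (x - y) * p y) @[n --> \oo] --> pi * p x.
Proof.
move=> mp L0 [pM pL].
have M0 : 0 <= M by exact: le_trans (pM 0).
pose e n : R := n.+1%:R^-1.
have e0 n : 0 < e n by rewrite invr_gt0.
have e01 n : 0 < e n <= 1 by rewrite e0 invf_le1// ler1n.
have pkx n := Rintegral_poisson x (e0 n).
have pk1 := Rintegral_poisson x (@ltr01 R).
have mpk n : measurable_fun [set: R] (fun y => poisson (e n) (x - y)) by exact: (L1_measurable (pkx n).1).
have [_ cv] : L1 (fun y : R => (0 : R)) /\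
   \int[mu]_y (poisson (e n) (x - y) * (p y - p x)) @[n --> \oo] --> \int[mu]_y (0 : R).
  apply: (@RintegralT_dominated_cvg _ _ _ (fun y => (L + 2 * (2 * M)) * poisson 1 (x - y))).
  - move=> n; apply: measurable_funM => //; exact: measurable_funB.
  - exact: measurable_cst.
  - by apply: L1Z; exact: pk1.1.
  - apply: ae_mono (ae_neq x) => y yx.
    have z2 : 0 < (x - y) ^+ 2.
      by rewrite exprn_even_gt0//= subr_eq0; apply/eqP => /esym.
    apply: norm_cvg0.
    have H : e n * ((x - y) ^- 2 * `|p y - p x|) @[n --> \oo] --> 0 * ((x - y) ^- 2 * `|p y - p x|).
      by apply: cvgMr_tmp; exact: cvg_harmonic.
    rewrite mul0r in H.
    apply: (squeeze_cvgr _ (cvg_cst 0) H); apply: nearW => n.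
    rewrite normr_ge0/= normrM (gtr0_norm (poisson_gt0 _ (e0 n))) mulrA ler_wpM2r//.
    rewrite /poisson ler_wpM2l ?(ltW (e0 n))// lef_pV2 ?posrE//; last by rewrite ltr_pwDl ?exprn_gt0 ?sqr_ge0.
    by rewrite lerDr sqr_ge0.
  - move=> n y; apply: poisson_increment_dom => //.
    rewrite (le_trans (ler_normB _ _))//; have := pM y; have := pM x; lra.
rewrite Rintegral_cst// mul0r in cv.
have E n : \int[mu]_y (poisson (e n) (x - y) * p y) = \int[mu]_y (poisson (e n) (x - y) * (p y - p x)) + pi * p x.
  have i1 : L1 (fun y => poisson (e n) (x - y) * p y).
    apply: (@L1_eq _ (fun y => p y * poisson (e n) (x - y))); first by move=> y; rewrite mulrC.
    by apply: L1M pM; [exact: (pkx n).1|].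
  have i2 : L1 (fun y => poisson (e n) (x - y) * p x).
    apply: (@L1_eq _ (fun y => p x * poisson (e n) (x - y))); first by move=> y; rewrite mulrC.
    by apply: L1Z; exact: (pkx n).1.
  rewrite -(pkx n).2 -RintegralZr//; last exact: (pkx n).1.
  rewrite -RintegralD//.
    by apply: eq_Rintegral => y _; ring.
  apply: (@L1_eq _ (fun y => poisson (e n) (x - y) * p y - poisson (e n) (x - y) * p x)); last exact: L1B.
  by move=> y; ring.
rewrite (_ : (fun n => _) = (fun n => \int[mu]_y (poisson (e n) (x - y) * (p y - p x)) + pi * p x)); last by apply/funext => n; rewrite E.
by rewrite -[X in _ --> X]add0r; apply: cvgD => //; exact: cvg_cst.
Qed.

Lemma poisson_pairing_cvg h p (L M : R) : L1 h -> L1 p -> 0 <= L ->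
  lipschitz_bounded p L M ->
  \int[mu]_x (h x * \int[mu]_y (poisson n.+1%:R^-1 (x - y) * p y)) @[n --> \oo] -->
  pi * \int[mu]_x (h x * p x).
Proof.
move=> hi pi_ L0 lp; have [pM pL] := lp.
have M0 : 0 <= M by exact: le_trans (pM 0).
have mp := L1_measurable pi_; have mh := L1_measurable hi.
pose e n : R := n.+1%:R^-1.
have e0 n : 0 < e n by rewrite invr_gt0.
have hpi : L1 (fun x => h x * p x).
  apply: (@L1_eq _ (fun y => p y * h y)); first by move=> y; rewrite mulrC.
  exact: L1M mp pM.
rewrite -RintegralZl//.
suff [] : L1 (fun x => pi * (h x * p x)) /\
  \int[mu]_x (h x * \int[mu]_y (poisson n.+1%:R^-1 (x - y) * p y)) @[n --> \oo] -->
  \int[mu]_x (pi * (h x * p x)) by [].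
apply: (@RintegralT_dominated_cvg _ (fun n x => h x * \int[mu]_y (poisson n.+1%:R^-1 (x - y) * p y))
   (fun x => pi * (h x * p x)) (fun x => M * pi * `|h x|)).
- move=> n; apply: measurable_funM => //.
  apply: (measurable_kernel_integral (m := fun x y => poisson (e n) (x - y)) (M := (e n)^-1)) => //.
    apply: (@measurableT_comp _ _ _ _ _ _ (poisson (e n))).
      apply: continuous_measurable_fun => z; apply: is_derive_continuous.
      have n2 : e n ^+ 2 + z ^+ 2 != 0 by rewrite gt_eqF// ltr_pwDl ?sqr_ge0// exprn_gt0.
      by apply: is_deriveM; apply: is_deriveV.
    by apply: measurable_funB; [exact: measurable_fst|exact: measurable_snd].
  by move=> x y; rewrite gtr0_norm ?poisson_gt0// poisson_le.
- by apply: measurable_funM => //; exact: measurable_funM.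
- by apply: L1Z; exact: integrable_norm.
- apply: ae_all => x.
  rewrite [X in _ --> X](_ : _ = h x * (pi * p x)); last by ring.
  by apply: cvgMl_tmp; exact: poisson_convol_cvg lp.
- move=> n x; rewrite normrM mulrC ler_wpM2r//.
  have [i1 E1] := Rintegral_poisson x (e0 n).
  rewrite -E1 -RintegralZl//; apply: RintegralT_norm_le.
  - apply: (@L1_eq _ (fun y => p y * poisson (e n) (x - y))); first by move=> y; rewrite mulrC.
    exact: L1M mp pM.
  - exact: L1Z.
  - by move=> y; rewrite normrM (gtr0_norm (poisson_gt0 _ (e0 n))) mulrC ler_wpM2r// ltW// poisson_gt0.
Qed.

Lemma plancherel_lipschitz h p (L M : R) : L1 h -> L1 p -> 0 <= L ->
  lipschitz_bounded p L M ->
  L1 (fun xi => fourier_cos h xi ^+ 2 + fourier_sin h xi ^+ 2) ->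
  2 * (pi * \int[mu]_x (h x * p x)) <=
  \int[mu]_xi (fourier_cos h xi ^+ 2 + fourier_sin h xi ^+ 2) + pi * \int[mu]_x (p x ^+ 2).
Proof.
move=> hi pi_ L0 lp Ni.
have c1 := poisson_pairing_cvg hi pi_ L0 lp.
have c2 := poisson_pairing_cvg pi_ pi_ L0 lp.
have c1' := cvgMl_tmp (a := 2) c1.
have c2' := cvgD (cvg_cst (\int[mu]_xi (fourier_cos h xi ^+ 2 + fourier_sin h xi ^+ 2))) c2.
rewrite (_ : \int[mu]_x (p x ^+ 2) = \int[mu]_x (p x * p x)); last first.
  by apply: eq_Rintegral => x _; rewrite expr2.
apply: (ler_cvg_to (c1' _) (c2' _ _)).
by apply: nearW => n; apply: poisson_energy_le.
Qed.

End poisson_limit.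

(** * The L^2 norm is controlled by the H^s norm *)

Section mollify.
Context {R : realType}.
Notation mu := (@lebesgue_measure R).
Notation L1 f := (mu.-integrable [set: R] (EFin \o f)).
Implicit Types h p : R -> R.

Lemma L1_bounded_support (f : R -> R) (M B : R) : measurable_fun [set: R] f ->
  (forall x, `|f x| <= M * \1_(`[-B, B]) x) -> L1 f.
Proof.
move=> mf fM; apply: (L1_le mf fM).
by apply: L1Z; exact: integrable_indic_itv.
Qed.

(** The Lipschitz test functions of the previous lemma are obtained from a bounded
    one by averaging it over [x, x + d]. By Lebesgue's differentiation theorem
    the averages converge almost everywhere as [d] tends to [0], and they are
    dominated. *)
Lemma plancherel_bounded h (psi : R -> R) (M B : R) : L1 h ->
  measurable_fun [set: R] psi -> 0 <= M -> (forall x, `|psi x| <= M * \1_(`[-B, B]) x) ->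
  L1 (fun xi => fourier_cos h xi ^+ 2 + fourier_sin h xi ^+ 2) ->
  2 * (pi * \int[mu]_x (h x * psi x)) <=
  \int[mu]_xi (fourier_cos h xi ^+ 2 + fourier_sin h xi ^+ 2) + pi * \int[mu]_x (psi x ^+ 2).
Proof.
move=> hi mpsi M0 psiM Ni.
have psii := L1_bounded_support mpsi psiM.
have psiM' x : `|psi x| <= M.
  apply: le_trans (psiM x) _; rewrite ler_piMr// indicE; by case: (_ \in _).
pose Psi (x : R) := \int[mu]_(t in `]-oo, x]) psi t.
have PsiB (p q : R) : p <= q -> Psi q - Psi p = \int[mu]_(t in `]p, q]) psi t.
  move=> pq; have := @Rintegral_itvB _ psi -oo%O (BRight q) p; rewrite bnd_simp; apply => //.
  exact: integrableS psii.
have psiS (p q : R) : mu.-integrable `]p, q] (EFin \o psi) by exact: integrableS psii.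
have PsiL (p q : R) : p <= q -> `|Psi q - Psi p| <= M * (q - p).
  move=> pq; rewrite PsiB// (le_trans (le_normr_Rintegral _ (psiS p q)))//.
  apply: (@le_trans _ _ (\int[mu]_(t in `]p, q]) M)).
    apply: le_Rintegral => //.
    - by apply: integrable_norm.
    - apply: measurable_bounded_integrable => //.
        by rewrite /= lebesgue_measure_itv/=; case: ifPn; rewrite ?ltry.
      exact: bounded_cst.
  rewrite Rintegral_cst//= lebesgue_measure_itv/= lte_fin; case: ifPn => [_|]; rewrite /= ?mulr0//.
  by move=> _; rewrite mulr_ge0// subr_ge0.
have Psi0 (p q : R) : p <= q -> q < -B \/ B <= p -> Psi q - Psi p = 0.
  move=> pq H; rewrite PsiB//.
  rewrite (_ : \int[mu]_(t in `]p, q]) psi t = \int[mu]_(t in `]p, q]) 0).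
    by rewrite Rintegral_cst// mul0r.
  apply: eq_Rintegral => t; rewrite inE/= in_itv/= => /andP[pt tq].
  apply/eqP; rewrite -normr_le0 (le_trans (psiM t))// indicE mem_setE in_itv/=.
  rewrite (_ : _ && _ = false) ?mulr0//; apply/negP => /andP[Bt tB].
  by case: H; lra.
pose d n : R := n.+1%:R^-1.
have d0 n : 0 < d n by rewrite invr_gt0.
(* the averages of [psi], supported in [-(B + 1), B + 1] since [d n <= 1] *)
pose p n x := (d n)^-1 * (Psi (x + d n) - Psi x).
have pM n x : `|p n x| <= M.
  rewrite normrM gtr0_norm ?invr_gt0// ler_pdivrMl// mulrC.
  by rewrite (le_trans (PsiL _ _ _)) ?lerDl ?(ltW (d0 n))// addrAC subrr add0r.
have Psi_lip x y : `|Psi x - Psi y| <= M * `|x - y|.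
  have [xy|/ltW yx] := leP x y.
    by rewrite distrC (le_trans (PsiL _ _ xy))// ler_wpM2l// distrC ler_norm.
  by rewrite (le_trans (PsiL _ _ yx))// ler_wpM2l// ler_norm.
have mPsi : measurable_fun [set: R] Psi.
  apply: continuous_measurable_fun => x; apply/cvgrPdist_le => e e0.
  have M1 : 0 < M + 1 by lra.
  near=> y; rewrite (le_trans (Psi_lip x y))//.
  rewrite (@le_trans _ _ ((M + 1) * `|x - y|))// ?ler_wpM2r//; first lra.
  rewrite mulrC -ler_pdivlMr//; near: y; apply: cvgr_dist_le => //.
  by rewrite divr_gt0.
have mp n : measurable_fun [set: R] (p n).
  apply: measurable_funM => //; apply: measurable_funB => //.
  by apply: measurableT_comp mPsi _; exact: measurable_funD.
have psupp n x : `|p n x| <= M * \1_(`[-(B + 1), B + 1]) x.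
  rewrite indicE mem_setE in_itv/=.
  have [/andP[a1 a2]|] := boolP (_ && _); first by rewrite mulr1.
  rewrite negb_and -!ltNge mulr0 => H.
  have dn1 : d n <= 1 by rewrite invf_le1// ler1n.
  rewrite /p Psi0 ?mulr0 ?normr0// ?lerDl ?(ltW (d0 n))//.
  by case/orP : H => H; [left|right]; lra.
have pi_ n : L1 (p n) by exact: L1_bounded_support (mp n) (psupp n).
have plip n : lipschitz_bounded (p n) (2 * M * (d n)^-1) M.
  split=> // x y; rewrite -mulrBr normrM gtr0_norm ?invr_gt0//.
  rewrite [leRHS](_ : _ = (d n)^-1 * (M * `|x - y| + M * `|x - y|)); last by ring.
  rewrite ler_wpM2l ?invr_ge0 ?(ltW (d0 n))//.
  rewrite (_ : _ - _ - _ = (Psi (y + d n) - Psi (x + d n)) - (Psi y - Psi x)); last by ring.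
  rewrite (le_trans (ler_normB _ _))// lerD// distrC (le_trans (Psi_lip _ _))// ler_wpM2l//.
  by rewrite opprD addrACA subrr addr0.
have pcv : {ae mu, forall x, p n x @[n --> \oo] --> psi x}.
  have loc : locally_integrable [set: R] psi.
    exact: open_integrable_locally openT psii.
  have iNy y : mu.-integrable `]-oo, y] (EFin \o psi) by exact: integrableS psii.
  apply: ae_mono (FTC1Ny iNy loc) => x [dPsi Psi'].
  move: dPsi => /cvg_ex[l /= H].
  have lE : l = psi x.
    rewrite -Psi' derive1E; apply/esym/cvg_lim => //.
  rewrite -lE; move/cvgr_dnbhsP : H => /(_ d).
  have H2 : (forall n, d n != 0) /\ d n @[n --> \oo] --> 0.
    by split; [move=> n; rewrite gt_eqF|exact: cvg_harmonic].
  move=> /(_ H2); rewrite (_ : (fun n => _) = p ^~ x)//.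
  by apply/funext => n; rewrite /p /GRing.scale /= mulr1 (addrC x).
have [_ cv1] : L1 (fun x => h x * psi x) /\
  \int[mu]_x (h x * p n x) @[n --> \oo] --> \int[mu]_x (h x * psi x).
  apply: (@RintegralT_dominated_cvg _ _ _ (fun x => M * `|h x|)).
  - by move=> n; apply: measurable_funM => //; exact: L1_measurable.
  - by apply: measurable_funM => //; exact: L1_measurable.
  - by apply: L1Z; exact: integrable_norm.
  - by apply: ae_mono pcv => x px; apply: cvgMl_tmp; exact: px.
  - by move=> n x; rewrite normrM mulrC ler_wpM2r.
have [_ cv2] : L1 (fun x => psi x ^+ 2) /\
  \int[mu]_x (p n x ^+ 2) @[n --> \oo] --> \int[mu]_x (psi x ^+ 2).
  apply: (@RintegralT_dominated_cvg _ _ _ (fun x => M * (M * \1_(`[-(B + 1), B + 1]) x))).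
  - by move=> n; exact: measurable_funX.
  - exact: measurable_funX.
  - by apply: L1Z; apply: L1Z; exact: integrable_indic_itv.
  - by apply: ae_mono pcv => x px; rewrite expr2; under eq_fun do rewrite expr2; exact: cvgM.
  - by move=> n x; rewrite normrX expr2 ler_pM.
have c1 := cvgMl_tmp (a := 2) (cvgMl_tmp (a := pi) cv1).
have c2 := cvgD (cvg_cst (\int[mu]_xi (fourier_cos h xi ^+ 2 + fourier_sin h xi ^+ 2))) (cvgMl_tmp (a := pi) cv2).
apply: (ler_cvg_to (c1 _ _) (c2 _ _ _)).
apply: nearW => n; apply: (plancherel_lipschitz hi (pi_ n) _ (plip n)) => //.
by rewrite !mulr_ge0// invr_ge0 ltW.
Unshelve. all: end_near. Qed.

End mollify.

Section plancherel.
Context {R : realType}.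
Notation mu := (@lebesgue_measure R).
Notation L1 f := (mu.-integrable [set: R] (EFin \o f)).
Implicit Types f g h : R -> R.

Lemma L2norm_sqr f : (\int[mu]_x (f x ^+ 2)%:E = (L2norm f `^ 2))%E.
Proof.
rewrite /L2norm poweR_Lnorm ?pnatr_eq0//; apply: eq_integral => x _ /=.
by rewrite powR_mulrn ?normr_ge0// real_normK// num_real.
Qed.

Lemma L2norm_le f (e : R) : measurable_fun [set: R] f -> 0 <= e ->
  (L2norm f <= e%:E)%E -> square_integrable f /\ \int[mu]_x (f x ^+ 2) <= e ^+ 2.
Proof.
move=> mf e0 fe.
have N0 : (0 <= L2norm f)%E by exact: Lnorm_ge0.
have H : (\int[mu]_x (f x ^+ 2)%:E <= (e ^+ 2)%:E)%E.
  rewrite L2norm_sqr -powR_mulrn// -poweR_EFin.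
  by apply: gt0_ler_poweR => //; rewrite ?in_itv/= ?leey ?andbT ?lee_fin.
split.
  split=> //; apply/integrableP; split.
    by apply/measurable_EFinP; exact: measurable_funX.
  under eq_integral do rewrite gee0_abs ?lee_fin ?sqr_ge0//.
  by rewrite (le_lt_trans H)// ltry.
rewrite /Rintegral -lee_fin fineK//.
rewrite ge0_fin_numE; first by rewrite (le_lt_trans H)// ltry.
by apply: integral_ge0 => x _; rewrite lee_fin sqr_ge0.
Qed.

Lemma Lfun_square_integrable f : f \in Lfun mu 2%:E -> square_integrable f.
Proof.
move=> fL; split; last exact: Lfun2_integrable_sqr.
by move: fL => /andP[]; rewrite inE.
Qed.

Lemma L2norm_cvg0_near (T : Type) (F : set_system T) (FF : Filter F) (f : T -> R -> R) (e : R) :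
  0 < e -> L2norm (f t) @[t --> F] --> 0%E -> \forall t \near F, (L2norm (f t) <= e%:E)%E.
Proof.
move=> e0 cv.
have : nbhs (0%E : \bar R) [set y | (y < e%:E)%E].
  by apply: open_ereal_lt'; rewrite lte_fin.
move=> /cv cvN.
have H : F [set t | (L2norm (f t) < e%:E)%E] by exact: cvN.
by apply: filterS H => t /ltW.
Qed.

Lemma trunc_reE f (A xi : R) :
  trunc_fourier_re f A xi = (Num.sqrt (2 * pi))^-1 * fourier_cos (fun x => \1_(`[-A, A]) x * f x) xi.
Proof.
rewrite /trunc_fourier_re /fourier_cos [in LHS]Rintegral_mkcond; congr (_ * _).
apply: eq_Rintegral => x _; rewrite patchE indicE.
by case: (_ \in _); rewrite /= ?mul1r ?mul0r ?mulr0// mulrC.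
Qed.

Lemma trunc_imE f (A xi : R) :
  trunc_fourier_im f A xi = - ((Num.sqrt (2 * pi))^-1 * fourier_sin (fun x => \1_(`[-A, A]) x * f x) xi).
Proof.
rewrite /trunc_fourier_im /fourier_sin [in LHS]Rintegral_mkcond; congr (- (_ * _)).
apply: eq_Rintegral => x _; rewrite patchE indicE.
by case: (_ \in _); rewrite /= ?mul1r ?mul0r ?mulr0// mulrC.
Qed.

Lemma square_integrable_L1_itv f (A : R) : square_integrable f -> L1 (fun x => \1_(`[-A, A]) x * f x).
Proof.
move=> [mf fi].
apply: (@L1_le _ _ (fun x => \1_(`[-A, A]) x + f x ^+ 2)).
- by apply: measurable_funM => //; exact: measurable_indic.
- move=> x; rewrite indicE; case: (_ \in _); rewrite /= ?mul1r ?mul0r ?normr0.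
    by have := sqr_ge0 (f x - 1); have := sqr_ge0 (f x + 1); have := sqr_ge0 (f x);
      rewrite ler_norml => *; apply/andP; split; nra.
  by rewrite add0r sqr_ge0.
- by apply: L1D => //; exact: integrable_indic_itv.
Qed.

(** The previous inequality is applied to [h], the restriction of [f] to
    [-A, A], and to the test function [f] cut off both in space and in height,
    for which [h * psi = psi ^+ 2]. *)
Lemma plancherel_trunc f (g1 g2 : R -> R) (A e : R) (n : nat) : square_integrable f -> square_integrable g1 -> square_integrable g2 ->
  0 <= e -> n%:R <= A ->
  (L2norm (fun xi => (g1 xi - trunc_fourier_re f A xi)%R) <= e%:E)%E ->
  (L2norm (fun xi => (g2 xi - trunc_fourier_im f A xi)%R) <= e%:E)%E ->
  \int[mu]_x ((if (`|x| <= n%:R) && (`|f x| <= n%:R) then f x else 0) ^+ 2) <=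
  4 * (\int[mu]_x (g1 x ^+ 2) + \int[mu]_x (g2 x ^+ 2)) + 8 * e ^+ 2.
Proof.
move=> fi g1i g2i e0 nA re im.
have [mf _] := fi.
pose h x := \1_(`[-A, A]) x * f x.
have hi : L1 h by exact: square_integrable_L1_itv.
pose c : R := (Num.sqrt (2 * pi))^-1.
have pi0 : 0 < pi :> R by exact: pi_gt0.
have c2 : c ^+ 2 = (2 * pi)^-1 by rewrite exprVn sqr_sqrtr// mulr_ge0// ltW.
have c0 : c != 0 by rewrite invr_neq0// gt_eqF// sqrtr_gt0 mulr_gt0.
pose r xi := trunc_fourier_re f A xi; pose s xi := trunc_fourier_im f A xi.
have mr : measurable_fun [set: R] r.
  rewrite (_ : r = fun xi => c * fourier_cos h xi); last by apply/funext => xi; exact: trunc_reE.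
  by apply: measurable_funM => //; exact: measurable_fourier_cos.
have ms : measurable_fun [set: R] s.
  rewrite (_ : s = fun xi => - (c * fourier_sin h xi)); last by apply/funext => xi; exact: trunc_imE.
  by apply: measurableT_comp => //; apply: measurable_funM => //; exact: measurable_fourier_sin.
have [dri dr] := L2norm_le (measurable_funB g1i.1 mr) e0 re.
have [dsi ds] := L2norm_le (measurable_funB g2i.1 ms) e0 im.
have ri : square_integrable r.
  have := square_integrableB g1i dri; rewrite (_ : (fun x => _) = r)//.
  by apply/funext => x; rewrite subKr.
have si : square_integrable s.
  have := square_integrableB g2i dsi; rewrite (_ : (fun x => _) = s)//.
  by apply/funext => x; rewrite subKr.
have tri (v w : R -> R) : square_integrable v -> square_integrable w -> \int[mu]_x (w x ^+ 2) <= 2 * \int[mu]_x (v x ^+ 2) + 2 * \int[mu]_x ((v x - w x) ^+ 2).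
  move=> vi wi; apply: le_trans (square_integrable_tri vi wi) _.
  by rewrite lerD2l ler_wpM2l//; under eq_Rintegral do rewrite -sqrrN opprB.
have rE := tri _ _ g1i ri; have sE := tri _ _ g2i si.
have NE xi : fourier_cos h xi ^+ 2 + fourier_sin h xi ^+ 2 = 2 * pi * (r xi ^+ 2) + 2 * pi * (s xi ^+ 2).
  rewrite /r /s trunc_reE trunc_imE -/h -/c sqrrN !exprMn c2.
  have pi2 : 2 * pi != 0 :> R by rewrite gt_eqF// mulr_gt0.
  by rewrite !mulVKf.
have Ni : L1 (fun xi => fourier_cos h xi ^+ 2 + fourier_sin h xi ^+ 2).
  apply: (@L1_eq _ (fun xi => 2 * pi * (r xi ^+ 2) + 2 * pi * (s xi ^+ 2))) => //.
  by apply: L1D; apply: L1Z; [exact: ri.2|exact: si.2].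
pose psi x := if (`|x| <= n%:R) && (`|f x| <= n%:R) then f x else 0.
have mpsi : measurable_fun [set: R] psi.
  apply: measurable_fun_ifT => //; apply: measurable_and; apply: measurable_fun_ler => //; exact: measurableT_comp.
have psiM x : `|psi x| <= n%:R * \1_(`[- n%:R, n%:R]) x.
  rewrite /psi indicE mem_setE in_itv/= -ler_norml.
  have [xn|xn] := boolP (`|x| <= n%:R); rewrite /= ?mulr1 ?mulr0 ?normr0//.
  by have [//|_] := boolP (`|f x| <= n%:R); rewrite normr0.
have := plancherel_bounded hi mpsi (ler0n _ _) psiM Ni.
have -> : \int[mu]_x (h x * psi x) = \int[mu]_x (psi x ^+ 2).
  apply: eq_Rintegral => x _; rewrite /h /psi indicE mem_setE in_itv/= -ler_norml.
  case: ifPn => [/andP[xn _]|]; last by rewrite mulr0 expr0n.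
  by rewrite (le_trans xn nA) mul1r expr2.
have -> : \int[mu]_xi (fourier_cos h xi ^+ 2 + fourier_sin h xi ^+ 2) = 2 * pi * (\int[mu]_x (r x ^+ 2) + \int[mu]_x (s x ^+ 2)).
  rewrite mulrDr -!RintegralZl//; [|exact: si.2|exact: ri.2].
  rewrite -RintegralD//; [|by apply: L1Z; exact: ri.2|by apply: L1Z; exact: si.2].
  by apply: eq_Rintegral => x _; exact: NE.
set X := \int[mu]_x (psi x ^+ 2) => H.
have {}H : X <= 2 * (\int[mu]_x (r x ^+ 2) + \int[mu]_x (s x ^+ 2)).
  by rewrite -(ler_pM2l pi0); lra.
apply: le_trans H _.
rewrite -/r -/s in dr ds; lra.
Qed.

(** Half of Plancherel's theorem, with a non optimal constant: it is what remains
    when the truncation at [A], then the cut-off at [n], are removed. *)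
Lemma plancherel f (g : (R -> R) * (R -> R)) : square_integrable f -> is_fourier f g ->
  \int[mu]_x (f x ^+ 2) <= 4 * (\int[mu]_x (g.1 x ^+ 2) + \int[mu]_x (g.2 x ^+ 2)).
Proof.
move=> fi [g1 g2 cv1 cv2].
have g1i := Lfun_square_integrable g1; have g2i := Lfun_square_integrable g2.
set G := _ + _.
pose psi n x := if (`|x| <= n%:R) && (`|f x| <= n%:R) then f x else 0.
have H n : \int[mu]_x (psi n x ^+ 2) <= 4 * G.
  apply/ler_addgt0Pr => e e0.
  (* so that the error term [8 * d ^+ 2] is [e] *)
  pose d := Num.sqrt (e / 8).
  have d0 : 0 < d by rewrite sqrtr_gt0 divr_gt0.
  have [A [/= nA [r s]]] : exists A : R, n%:R <= A /\
     (L2norm (fun xi => (g.1 xi - trunc_fourier_re f A xi)%R) <= d%:E)%E /\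
     (L2norm (fun xi => (g.2 xi - trunc_fourier_im f A xi)%R) <= d%:E)%E.
    have n1 := L2norm_cvg0_near _ d0 cv1; have n2 := L2norm_cvg0_near _ d0 cv2.
    near (+oo : set_system R) => A; exists A; split.
      by near: A; exact: nbhs_pinfty_ge.
    by split; near: A; [exact: n1|exact: n2].
  have := plancherel_trunc fi g1i g2i (ltW d0) nA r s.
  by rewrite sqr_sqrtr ?divr_ge0 ?(ltW e0)//; rewrite (_ : 8 * (e / 8) = e)//; field.
have [mf f2] := fi.
have mpsi n : measurable_fun [set: R] (psi n).
  apply: measurable_fun_ifT => //; apply: measurable_and; apply: measurable_fun_ler => //; exact: measurableT_comp.
have [_ cv] : L1 (fun x => f x ^+ 2) /\
  \int[mu]_x (psi n x ^+ 2) @[n --> \oo] --> \int[mu]_x (f x ^+ 2).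
  apply: (@RintegralT_dominated_cvg _ _ _ (fun x => f x ^+ 2)) => //.
  - by move=> n; exact: measurable_funX.
  - exact: measurable_funX.
  - apply: ae_all => x; apply: cvg_near_cst; near=> n; rewrite /psi.
    rewrite (_ : `|x| <= n%:R); last by near: n; exact: nbhs_infty_ger.
    by rewrite (_ : `|f x| <= n%:R)//; near: n; exact: nbhs_infty_ger.
  - move=> n x; rewrite /psi; case: ifPn => _; first by rewrite ger0_norm ?sqr_ge0.
    by rewrite expr0n/= normr0 sqr_ge0.
apply: (ler_cvg_to cv (cvg_cst (4 * G))); exact: nearW.
Unshelve. all: end_near. Qed.

(** For [s >= 0] the weight [(1 + xi ^+ 2) `^ (s / 2)] is at least [1]. This is how
    the continuity in time with values in H^s is turned into continuity with
    values in L^2. *)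
Lemma plancherel_Hs f (s e : R) : square_integrable f -> 0 <= s -> 0 < e -> (Hs_norm s f < e%:E)%E ->
  \int[mu]_x (f x ^+ 2) <= 4 * e ^+ 2.
Proof.
move=> fi s0 e0 /ereal_inf_lt[_ [g /= fg <-] ge].
apply: le_trans (plancherel fi fg) _; rewrite ler_wpM2l//.
have [g1 g2 _ _] := fg.
have [mg1 g1i] := Lfun_square_integrable g1; have [mg2 g2i] := Lfun_square_integrable g2.
set F := fun xi => _ in ge.
have mF : measurable_fun [set: R] F.
  apply: measurable_funM.
    apply: (@measurableT_comp _ _ _ _ _ _ (fun x : R => x `^ (s / 2))) => //.
    by apply: measurable_funD => //; exact: measurable_funX.
  apply: (@measurableT_comp _ _ _ _ _ _ (@Num.sqrt R)).
    by apply: continuous_measurable_fun; exact: sqrt_continuous.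
  by apply: measurable_funD => //; exact: measurable_funX.
have [[_ Fi] Fe] := L2norm_le mF (ltW e0) (ltW ge).
apply: le_trans Fe; rewrite -RintegralD//; apply: RintegralT_le => //.
  exact: L1D.
move=> xi; rewrite /F exprMn sqr_sqrtr ?addr_ge0 ?sqr_ge0//.
rewrite ler_peMl ?addr_ge0 ?sqr_ge0// -[leLHS](expr1n _ 2) ler_sqr ?nnegrE ?powR_ge0//.
rewrite -[leLHS](powRr0 (1 + xi ^+ 2)) ler_powR ?divr_ge0//.
by rewrite lerDl sqr_ge0.
Qed.

End plancherel.

(** * Functions of class C^n in space, uniformly in time *)

Section time_continuous.
Context {R : realType}.
Notation mu := (@lebesgue_measure R).
Variable T : R.
Implicit Types (f g : R -> R) (H K : R -> R -> R) (Omega : set R).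

Definition time_continuous f := {within `[0, T], continuous f}.

Lemma time_continuousP f : time_continuous f <-> forall t, 0 <= t <= T -> forall e, 0 < e ->
  \forall r \near t, 0 <= r <= T -> `|f r - f t| <= e.
Proof.
split=> cf.
  move=> t t0T e e0; have := (subspace_continuousP _ _).1 cf t.
  rewrite /= in_itv/= => /(_ t0T)/cvgrPdist_le/(_ e e0).
  move=> cfe; have H : nbhs t (fun r => `[0, T]%classic r -> `|f t - f r| <= e) by exact: cfe.
  by apply: filterS H => r Hr rT; rewrite distrC; apply: Hr; rewrite /= in_itv.
apply/subspace_continuousP => t /=; rewrite in_itv/= => t0T.
apply/cvgrPdist_le => e e0; apply: filterS (cf t t0T e e0) => r /= fr.
by rewrite in_itv/= distrC.
Qed.

Lemma time_continuous_sub f p q : time_continuous f -> 0 <= p -> q <= T -> {within `[p, q], continuous f}.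
Proof.
move=> cf p0 qT; apply: continuous_subspaceW cf.
by move=> r /=; rewrite !in_itv/= => /andP[pr rq]; apply/andP; split; lra.
Qed.

Lemma time_continuous_integrable f p q : time_continuous f -> 0 <= p -> q <= T ->
  mu.-integrable `[p, q] (EFin \o f).
Proof.
move=> cf p0 qT; apply: continuous_compact_integrable; first exact: segment_compact.
exact: time_continuous_sub.
Qed.

Lemma time_continuous_bounded f : time_continuous f -> exists2 M, 0 <= M & forall r, 0 <= r <= T -> `|f r| <= M.
Proof.
move=> cf.
have := compact_bounded (continuous_compact cf (@segment_compact _ 0 T)).
move=> [M [_ HM]]; exists (`|M| + 1); first by rewrite addr_ge0.
move=> r r0T; apply: (HM (`|M| + 1)).
  by rewrite (le_lt_trans (ler_norm M))// ltrDl.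
by exists r => //; rewrite /= in_itv.
Qed.

Lemma time_continuousD f g : time_continuous f -> time_continuous g -> time_continuous (fun r => f r + g r).
Proof. by move=> cf cg t; apply: cvgD; [exact: cf|exact: cg]. Qed.

Lemma time_continuousB f g : time_continuous f -> time_continuous g -> time_continuous (fun r => f r - g r).
Proof. by move=> cf cg t; apply: cvgB; [exact: cf|exact: cg]. Qed.

Lemma time_continuousM f g : time_continuous f -> time_continuous g -> time_continuous (fun r => f r * g r).
Proof. by move=> cf cg t; apply: cvgM; [exact: cf|exact: cg]. Qed.

Lemma time_continuous_cst (c : R) : time_continuous (fun=> c).
Proof. by move=> t; exact: cvg_cst. Qed.

(** Together with the continuity in time, this says that [y |-> H ^~ y] is
    continuous at [x] as a map into the Banach algebra of continuous functions on
    [0, T]. Uniformity in time is what makes the integral in time preserve the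
    regularity in space. *)
Definition time_equicontinuous H x := forall e, 0 < e ->
  \forall y \near x, forall r, 0 <= r <= T -> `|H r y - H r x| <= e.

Definition time_C0 Omega H := forall x, Omega x -> time_continuous (H ^~ x) /\ time_equicontinuous H x.

Lemma time_C0_bounded Omega H x : time_C0 Omega H -> Omega x ->
  exists2 M, 0 <= M & \forall y \near x, forall r, 0 <= r <= T -> `|H r y| <= M.
Proof.
move=> cH Ox; have [ct ce] := cH x Ox.
have [M M0 HM] := time_continuous_bounded ct.
exists (M + 1); first by rewrite addr_ge0.
apply: filterS (ce 1 ltr01) => y Hy r rT.
have := HM r rT; have := Hy r rT; have := ler_normD (H r y - H r x) (H r x).
rewrite subrK; lra.
Qed.

Lemma time_C0D Omega H K : time_C0 Omega H -> time_C0 Omega K -> time_C0 Omega (fun r x => H r x + K r x).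
Proof.
move=> cH cK x Ox; have [ct ce] := cH x Ox; have [kt ke] := cK x Ox.
split; first exact: time_continuousD.
move=> e e0; have e2 : 0 < e / 2 by rewrite divr_gt0.
apply: filterS2 (ce _ e2) (ke _ e2) => y Hy Ky r rT.
rewrite opprD addrACA (le_trans (ler_normD _ _))//.
have := Hy r rT; have := Ky r rT; lra.
Qed.

Lemma time_C0M Omega H K : time_C0 Omega H -> time_C0 Omega K -> time_C0 Omega (fun r x => H r x * K r x).
Proof.
move=> cH cK x Ox; have [ct ce] := cH x Ox; have [kt ke] := cK x Ox.
split; first exact: time_continuousM.
have [M M0 HM] := time_C0_bounded cH Ox; have [N N0 KN] := time_C0_bounded cK Ox.
move=> e e0; pose d := e / (M + N + 1).
have MN : 0 < M + N + 1 by lra.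
have d0 : 0 < d by rewrite divr_gt0.
have de : e = d * (M + N + 1) by rewrite /d divfK// gt_eqF.
have HMx := nbhs_singleton HM; have KNx := nbhs_singleton KN.
have C1 : \forall y \near x, forall r, 0 <= r <= T -> `|H r y - H r x| <= d by exact: ce.
have C2 : \forall y \near x, forall r, 0 <= r <= T -> `|K r y - K r x| <= d by exact: ke.
near=> y => r rT.
have HMy : forall r, 0 <= r <= T -> `|H r y| <= M by near: y.
have Hy : forall r, 0 <= r <= T -> `|H r y - H r x| <= d by near: y.
have Ky : forall r, 0 <= r <= T -> `|K r y - K r x| <= d by near: y.
rewrite (_ : _ - _ = H r y * (K r y - K r x) + (H r y - H r x) * K r x); last by ring.
rewrite (le_trans (ler_normD _ _))// !normrM.
have h1 := ler_pM (normr_ge0 _) (normr_ge0 _) (HMy r rT) (Ky r rT).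
have h2 := ler_pM (normr_ge0 _) (normr_ge0 _) (Hy r rT) (KNx r rT).
rewrite de; nra.
Unshelve. all: by end_near. Qed.

Lemma time_C0_cst Omega (c : R) : time_C0 Omega (fun _ _ => c).
Proof.
move=> x Ox; split; first exact: time_continuous_cst.
by move=> e e0; near=> y => r _; rewrite subrr normr0 ltW.
Unshelve. all: by end_near.
Qed.

(** [time_Ck n Omega H]: the map [x |-> H ^~ x] is of class C^n on [Omega] with values
    in the continuous functions of time. The successive derivatives are exhibited
    rather than computed, so that linear combinations, products and integrals in
    time are handled by plain inductions. A function of space alone is viewed as
    a constant function of time. *)
Fixpoint time_Ck n Omega H : Prop := time_C0 Omega H /\
  match n with
  | 0 => True
  | m.+1 => exists2 H', time_Ck m Omega H' &
      forall r x, 0 <= r <= T -> Omega x -> is_derive x 1 (H r) (H' r x)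
  end.

Lemma time_Ck_C0 n Omega H : time_Ck n Omega H -> time_C0 Omega H.
Proof. by case: n => [|n] []. Qed.

Lemma time_CkW n Omega H : time_Ck n.+1 Omega H -> time_Ck n Omega H.
Proof.
elim: n H => [|n IH] H [H0 [H' H1 H2]] //.
by split=> //; exists H' => //; exact: IH.
Qed.

Lemma time_Ck_cst n Omega (c : R) : time_Ck n Omega (fun _ _ => c).
Proof.
elim: n c => [|n IH] c; (split; first exact: time_C0_cst) => //.
by exists (fun _ _ => 0) => // r x _ _; exact: is_derive_cst.
Qed.

Lemma time_CkD n Omega H K : time_Ck n Omega H -> time_Ck n Omega K -> time_Ck n Omega (fun r x => H r x + K r x).
Proof.
elim: n H K => [|n IH] H K [H0 H1] [K0 K1]; split=> //; try exact: time_C0D.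
have [H' ? dH] := H1; have [K' ? dK] := K1.
exists (fun r x => H' r x + K' r x); first exact: IH.
by move=> r x rT Ox; apply: is_deriveD; [exact: dH|exact: dK].
Qed.

Lemma time_CkM n Omega H K : time_Ck n Omega H -> time_Ck n Omega K -> time_Ck n Omega (fun r x => H r x * K r x).
Proof.
elim: n H K => [|n IH] H K tH tK.
  by split=> //; apply: time_C0M; [exact: time_Ck_C0 tH|exact: time_Ck_C0 tK].
have [H0 [H' tH' dH]] := tH; have [K0 [K' tK' dK]] := tK.
split; first exact: time_C0M.
exists (fun r x => H r x * K' r x + K r x * H' r x).
  by apply: time_CkD; apply: IH => //; exact: time_CkW.
move=> r x rT Ox; have h := dH r x rT Ox; have k := dK r x rT Ox.
exact: is_deriveM.
Qed.

Lemma time_CkZ n Omega (c : R) H : time_Ck n Omega H -> time_Ck n Omega (fun r x => c * H r x).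
Proof. by move=> tH; apply: time_CkM => //; exact: time_Ck_cst. Qed.

Lemma eq_time_Ck n Omega H K : (forall r x, H r x = K r x) -> time_Ck n Omega H -> time_Ck n Omega K.
Proof. by move=> HK; rewrite (_ : H = K)//; apply/funext => r; apply/funext => x. Qed.

End time_continuous.

Section time_integral.
Context {R : realType}.
Notation mu := (@lebesgue_measure R).
Implicit Types (f g : R -> R) (H K : R -> R -> R) (Omega : set R).

Lemma is_derive_eps f (x l : R) :
  (forall e, 0 < e -> \forall y \near x, `|f y - f x - (y - x) * l| <= e * `|y - x|) ->
  is_derive x 1 f l.
Proof.
move=> fl.
have cv : h^-1 *: ((f \o shift x) (h *: 1) - f x) @[h --> 0^'] --> l.
  apply/cvgrPdist_le => e e0.
  have /nbhs_ballP[d /= d0 Hd] := fl e e0.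
  exists d => //= h hd h0.
  have hd' : `|- h| < d by move: hd; rewrite /ball_/= sub0r.
  have := Hd (h + x).
  rewrite /ball/= opprD addrCA subrr addr0 => /(_ hd').
  rewrite addrK distrC /GRing.scale/= mulr1 => Hh.
  rewrite -(ler_pM2l (_ : 0 < `|h|)) ?normr_gt0// -normrM mulrBr mulrA divff// mul1r.
  by rewrite (mulrC `|h|).
by apply: DeriveDef; [exact: cvgP cv|exact: cvg_lim cv].
Qed.

Lemma MVT_ball f (df : R -> R) (x y d : R) :
  (forall z, `|x - z| < d -> is_derive z 1 f (df z)) -> `|x - y| < d ->
  exists2 z, `|x - z| < d & f y - f x = df z * (y - x).
Proof.
move=> fd yd.
have cf z : `|x - z| < d -> {for z, continuous f}.
  by move=> /fd ?; exact: is_derive_continuous.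
have H (p q : R) : p <= q -> (forall z, p <= z <= q -> `|x - z| < d) ->
    exists2 z, `|x - z| < d & f q - f p = df z * (q - p).
  move=> pq sub.
  have [z| |z zpq ->] := @MVT_segment _ f df p q pq.
  - by rewrite in_itv/= => /andP[pz zq]; apply: fd; apply: sub; rewrite !ltW.
  - apply: derivable_within_continuous => z; rewrite in_itv/= => zpq.
    by have [] := fd z (sub z zpq).
  - by exists z => //; apply: sub; move: zpq; rewrite in_itv.
have [xy|yx] := leP x y.
  apply: H => // z /andP[xz zy].
  apply: le_lt_trans yd; rewrite ler0_norm ?subr_le0// ler0_norm ?subr_le0//; lra.
have [|z zd E] := H y x (ltW yx).
  move=> z /andP[xz zy].
  apply: le_lt_trans yd; rewrite ger0_norm ?subr_ge0// gtr0_norm ?subr_gt0//; lra.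
exists z => //; rewrite -opprB E; ring.
Qed.

Variable T : R.
Hypothesis T0 : 0 <= T.

Definition time_integral H t x := \int[mu]_(r in `[0, t]) H r x.

Lemma time_integral_bound f (p q M : R) : time_continuous T f -> 0 <= p -> p <= q -> q <= T ->
  (forall r, p <= r <= q -> `|f r| <= M) ->
  `|\int[mu]_(r in `[p, q]) f r| <= M * (q - p).
Proof.
move=> cf p0 pq qT fM; have fi := time_continuous_integrable cf p0 qT.
rewrite (le_trans (le_normr_Rintegral _ fi))//.
have -> : M * (q - p) = \int[mu]_(r in `[p, q]) M.
  rewrite Rintegral_cst//= lebesgue_measure_itv/= lte_fin; case: ltgtP pq => //= -> _.
  by rewrite subrr.
apply: le_Rintegral => //; first exact: integrable_norm.
by apply: time_continuous_integrable p0 qT; exact: time_continuous_cst.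
Qed.

Lemma time_integralB H t x y : 0 <= t <= T -> time_continuous T (H ^~ x) -> time_continuous T (H ^~ y) ->
  time_integral H t y - time_integral H t x = \int[mu]_(r in `[0, t]) (H r y - H r x).
Proof.
move=> /andP[t0 tT] cx cy; rewrite /time_integral RintegralB//; exact: time_continuous_integrable.
Qed.

Lemma time_continuous_integral f : time_continuous T f -> time_continuous T (fun t => \int[mu]_(r in `[0, t]) f r).
Proof.
move=> cf; exact: parameterized_integral_continuous T0 (time_continuous_integrable cf (lexx 0) (lexx T)).
Qed.

Lemma time_C0_integral Omega H : open Omega -> time_C0 T Omega H -> time_C0 T Omega (time_integral H).
Proof.
move=> oO cH x Ox; have [ct ce] := cH x Ox.
split; first exact: time_continuous_integral.
move=> e e0; pose k := e / (T + 1).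
have T1 : 0 < T + 1 by rewrite ltr_wpDl.
have k0 : 0 < k by rewrite divr_gt0.
have ke : e = k * (T + 1) by rewrite /k divfK// gt_eqF.
have C1 : \forall y \near x, forall r, 0 <= r <= T -> `|H r y - H r x| <= k by exact: ce.
have C2 : \forall y \near x, Omega y by exact: open_nbhs_nbhs.
near=> y => t tT.
have Oy : Omega y by near: y.
have Hy : forall r, 0 <= r <= T -> `|H r y - H r x| <= k by near: y.
have cy := (cH y Oy).1; have /andP[t0 tT'] := tT.
rewrite time_integralB//; apply: (@le_trans _ _ (k * (t - 0))).
  apply: (@time_integral_bound (fun r => H r y - H r x)) => //.
    by apply: time_continuousB.
  by move=> r /andP[r0 rt]; apply: Hy; rewrite r0 (le_trans rt).
rewrite ke ler_wpM2l ?(ltW k0)//; lra.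
Unshelve. all: by end_near. Qed.

(** Differentiation under the integral sign: by the mean value theorem, the
    remainder of the first order expansion of [H r] at [x] is controlled by the
    oscillation of [H' r], uniformly in [r]. *)
Lemma time_integral_derive Omega H H' t x : open Omega ->
  (forall x, Omega x -> time_continuous T (H ^~ x)) -> time_C0 T Omega H' ->
  (forall r x, 0 <= r <= T -> Omega x -> is_derive x 1 (H r) (H' r x)) ->
  0 <= t <= T -> Omega x -> is_derive x 1 (time_integral H t) (time_integral H' t x).
Proof.
move=> oO cH cH' dH tT Ox; have [ct ce] := cH' x Ox.
have /andP[t0 tT'] := tT.
apply: is_derive_eps => e e0; pose k := e / (T + 1).
have T1 : 0 < T + 1 by rewrite ltr_wpDl.
have k0 : 0 < k by rewrite divr_gt0.
have ke : e = k * (T + 1) by rewrite /k divfK// gt_eqF.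
have /nbhs_ballP[d /= d0 Hd] : \forall y \near x, Omega y /\ forall r, 0 <= r <= T -> `|H' r y - H' r x| <= k.
  by apply: filterI; [exact: open_nbhs_nbhs|exact: ce].
apply/nbhs_ballP; exists d => // y; rewrite /ball/= => yd.
have Oy := (Hd y yd).1.
have ctD : time_continuous T (fun r => (H r y - H r x) - (y - x) * H' r x).
  apply: (@time_continuousB _ T (fun r => H r y - H r x) (fun r => (y - x) * H' r x)).
    by apply: time_continuousB; exact: cH.
  by apply: time_continuousM; [exact: time_continuous_cst|exact: ct].
have E : time_integral H t y - time_integral H t x - (y - x) * time_integral H' t x =
    \int[mu]_(r in `[0, t]) ((H r y - H r x) - (y - x) * H' r x).
  rewrite RintegralB//; last 2 first.
  - apply: (@time_continuous_integrable _ T (fun r => H r y - H r x)) => //.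
    by apply: time_continuousB; exact: cH.
  - apply: (@time_continuous_integrable _ T (fun r => (y - x) * H' r x)) => //.
    by apply: time_continuousM; [exact: time_continuous_cst|exact: ct].
  rewrite time_integralB ?RintegralZl//; [exact: time_continuous_integrable|exact: cH|exact: cH].
rewrite E; apply: (@le_trans _ _ ((k * `|y - x|) * (t - 0))).
  apply: time_integral_bound => // r /andP[r0 rt].
  have rT : 0 <= r <= T by rewrite r0 (le_trans rt).
  have [z zd ->] := @MVT_ball (H r) (H' r) x y d (fun z zd => dH r z rT (Hd z zd).1) yd.
  rewrite (mulrC (y - x)) -mulrBl normrM ler_wpM2r//.
  exact: (Hd z zd).2.
rewrite ke subr0 mulrAC ler_wpM2r// ler_wpM2l ?(ltW k0)//; lra.
Qed.

Lemma time_Ck_integral n Omega H : open Omega -> time_Ck T n Omega H -> time_Ck T n Omega (time_integral H).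
Proof.
move=> oO; elim: n H => [|n IH] H [H0 H1]; (split; first exact: time_C0_integral) => //.
have [H' tH' dH] := H1; exists (time_integral H'); first exact: IH.
move=> t x tT Ox; apply: (@time_integral_derive Omega) => //.
- by move=> y Oy; exact: (H0 y Oy).1.
- exact: time_Ck_C0 tH'.
Qed.

End time_integral.

(** * The classes C^(k + theta) *)

Section Ck.
Context {R : realType}.
Implicit Types (f g : R -> R) (H K : R -> R -> R) (Omega : set R) (theta : R).

Lemma near_pairP (P : R -> R -> Prop) (x : R) :
  (\forall y \near x & z \near x, P y z) <->
  exists2 d, 0 < d & forall y z, `|x - y| < d -> `|x - z| < d -> P y z.
Proof.
split=> [[[A B] /= [/nbhs_ballP[a /= a0 aA] /nbhs_ballP[b /= b0 bB]] AB]|[d d0 dP]].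
  exists (Num.min a b); first by rewrite lt_min a0.
  move=> y z; rewrite !lt_min => /andP[ya _] /andP[_ zb].
  by apply: (AB (y, z)); split; [exact: aA|exact: bB].
exists (ball x d, ball x d); first by split; exact: nbhsx_ballx.
by move=> [y z] /= [yd zd]; exact: dP.
Qed.

Lemma locally_holderP theta Omega g : locally_holder theta Omega g <->
  forall x, Omega x -> exists C d, 0 < d /\ forall y z, `|x - y| < d -> `|x - z| < d ->
    `|g y - g z| <= C * `|y - z| `^ theta.
Proof.
split=> h x Ox.
  by have [C /near_pairP[d d0 H]] := h x Ox; exists C, d.
by have [C [d [d0 H]]] := h x Ox; exists C; apply/near_pairP; exists d.
Qed.

Lemma Cktheta0 theta Omega g : Cktheta 0 theta Omega g <->
  (forall x, Omega x -> {for x, continuous g}) /\ (0 < theta -> locally_holder theta Omega g).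
Proof. by split=> [[]|[? ?]]; rewrite /derive1n/=; split. Qed.

(** The recursion on [k] by which all the properties of these classes are
    proved. *)
Lemma CkthetaS k theta Omega g : Cktheta k.+1 theta Omega g <->
  (forall x, Omega x -> derivable g x 1) /\ Cktheta k theta Omega (derive1 g).
Proof.
split=> [[h1 h2 h3]|[d [h1 h2 h3]]].
  split; first by move=> x Ox; exact: (h1 0%N).
  split; rewrite -?derive1Sn//.
  by move=> i x ik Ox; rewrite -derive1Sn; exact: h1.
split; rewrite ?derive1Sn//.
by move=> [|i] x ik Ox; [exact: d|rewrite derive1Sn; exact: h1].
Qed.

Lemma Cktheta_eq k theta Omega f g : open Omega -> (forall x, Omega x -> f x = g x) ->
  Cktheta k theta Omega f -> Cktheta k theta Omega g.
Proof.
move=> oO; elim: k f g => [|k IH] f g fg.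
  move=> /Cktheta0[cf hf]; apply/Cktheta0; split.
    move=> x Ox; have fgx : \forall y \near x, f y = g y.
      have : \forall y \near x, Omega y by exact: open_nbhs_nbhs.
      by apply: filterS => y /fg.
    have := cf x Ox; rewrite /prop_for /continuous_at -fg//.
    by apply: cvg_trans; apply: near_eq_cvg; apply: filterS fgx.
  move=> t0; apply/locally_holderP => x Ox.
  have [C [d [d0 HC]]] := (locally_holderP _ _ _).1 (hf t0) x Ox.
  have /nbhs_ballP[d' /= d'0 Od] : nbhs x Omega by exact: open_nbhs_nbhs.
  exists C, (Num.min d d'); split; first by rewrite lt_min d0.
  move=> y z; rewrite !lt_min => /andP[yd yd'] /andP[zd zd'].
  by rewrite -!fg; [exact: HC|exact: Od|exact: Od].
move=> /CkthetaS[df tf]; apply/CkthetaS.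
have near_fg x : Omega x -> \forall y \near x, f y = g y.
  move=> Ox; have : \forall y \near x, Omega y by exact: open_nbhs_nbhs.
  by apply: filterS => y /fg.
split.
  by move=> x Ox; apply: near_eq_derivable (df x Ox); exact: near_fg.
apply: IH tf => x Ox; rewrite !derive1E; apply: near_eq_derive; exact: near_fg.
Qed.

Lemma CkthetaD k theta Omega f g : open Omega ->
  Cktheta k theta Omega f -> Cktheta k theta Omega g ->
  Cktheta k theta Omega (fun x => f x + g x).
Proof.
move=> oO; elim: k f g => [|k IH] f g.
  move=> /Cktheta0[cf hf] /Cktheta0[cg hg]; apply/Cktheta0; split.
    by move=> x Ox; apply: cvgD; [exact: cf|exact: cg].
  move=> t0; apply/locally_holderP => x Ox.
  have [C [d [d0 HC]]] := (locally_holderP _ _ _).1 (hf t0) x Ox.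
  have [D [d' [d'0 HD]]] := (locally_holderP _ _ _).1 (hg t0) x Ox.
  exists (C + D), (Num.min d d'); split; first by rewrite lt_min d0.
  move=> y z; rewrite !lt_min => /andP[yd yd'] /andP[zd zd'].
  rewrite opprD addrACA mulrDl (le_trans (ler_normD _ _))// lerD//.
  - exact: HC.
  - exact: HD.
move=> /CkthetaS[df tf] /CkthetaS[dg tg]; apply/CkthetaS; split.
  by move=> x Ox; apply: derivableD; [exact: df|exact: dg].
apply: Cktheta_eq (IH _ _ tf tg) => // x Ox.
by rewrite !derive1E deriveD//; [exact: df|exact: dg].
Qed.

Lemma CkthetaN k theta Omega f : open Omega ->
  Cktheta k theta Omega f -> Cktheta k theta Omega (fun x => - f x).
Proof.
move=> oO; elim: k f => [|k IH] f.
  move=> /Cktheta0[cf hf]; apply/Cktheta0; split.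
    by move=> x Ox; apply: cvgN; exact: cf.
  move=> t0; apply/locally_holderP => x Ox.
  have [C [d [d0 HC]]] := (locally_holderP _ _ _).1 (hf t0) x Ox.
  exists C, d; split=> // y z yd zd.
  by rewrite -opprD normrN; exact: HC.
move=> /CkthetaS[df tf]; apply/CkthetaS; split.
  by move=> x Ox; apply: derivableN; exact: df.
apply: Cktheta_eq (IH _ tf) => // x Ox.
by rewrite !derive1E deriveN//; exact: df.
Qed.

Variable T : R.
Hypothesis T0 : 0 <= T.

Lemma Cktheta_time_Ck k theta Omega g : open Omega -> Cktheta k theta Omega g ->
  time_Ck T k Omega (fun _ => g).
Proof.
move=> oO.
have base h : (forall x, Omega x -> {for x, continuous h}) -> time_C0 T Omega (fun _ => h).
  move=> ch x Ox; split; first exact: time_continuous_cst.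
  move=> e e0; have /cvgrPdist_le/(_ e e0) := ch x Ox.
  by apply: filterS => y hy r _; rewrite distrC.
elim: k g => [|k IH] g.
  by move=> /Cktheta0[cg _]; split=> //; exact: base.
move=> /CkthetaS[dg tg]; split.
  apply: base => x Ox; apply: differentiable_continuous; apply/derivable1_diffP; exact: dg.
exists (fun _ => (derive1 g)); first exact: IH.
by move=> r x _ Ox; apply: DeriveDef; [exact: dg|rewrite derive1E].
Qed.

Lemma time_Ck_le j k Omega H : (j <= k)%N -> time_Ck T k Omega H -> time_Ck T j Omega H.
Proof.
move=> jk; rewrite -(subnK jk); elim: (k - j)%N => [|n IH]; rewrite ?add0n//.
by rewrite addSn => /time_CkW/IH.
Qed.


(** A C^1 function is locally Lipschitz, and [`|y - z| <= `|y - z| `^ theta] for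
    points at distance at most [1]. *)
Lemma time_C1_locally_holder theta Omega H t : open Omega -> 0 <= theta <= 1 -> time_Ck T 1 Omega H -> 0 <= t <= T ->
  locally_holder theta Omega (H t).
Proof.
move=> oO /andP[th0 th1] [H0 [H' [H'0 _] dH]] tT; apply/locally_holderP => x Ox.
have [M M0 HM] := time_C0_bounded H'0 Ox; exists M.
have /nbhs_ballP[d /= d0 Hd] : \forall y \near x, Omega y /\ forall r, 0 <= r <= T -> `|H' r y| <= M.
  by apply: filterI => //; exact: open_nbhs_nbhs.
pose k := Num.min d 2^-1.
have k0 : 0 < k by rewrite lt_min d0 invr_gt0/=.
have L (p q : R) : p <= q -> `|x - p| < k -> `|x - q| < k -> `|H t q - H t p| <= M * `|q - p| `^ theta.
  rewrite !lt_min => pq /andP[pd p2] /andP[qd q2].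
  have sub z : p <= z <= q -> ball x d z.
    move=> /andP[pz zq]; rewrite /ball/=; move: pd qd; rewrite !ltr_norml => /andP[? ?] /andP[? ?].
    by apply/andP; split; lra.
  have [z| |z zpq ->] := @MVT_segment _ (H t) (H' t) p q pq.
  - by rewrite in_itv/= => /andP[pz zq]; apply: dH => //; apply: (Hd z _).1; apply: sub; rewrite !ltW.
  - apply: derivable_within_continuous => z; rewrite in_itv/= => zpq.
    by have [] := dH t z tT (Hd z (sub z zpq)).1.
  rewrite in_itv/= in zpq.
  rewrite normrM ler_pM//; first exact: (Hd z (sub z zpq)).2.
  have qp1 : `|q - p| <= 1.
    have := ler_distD x q p; rewrite (distrC q x) => h; apply: (le_trans h); lra.
  have [->|n0] := eqVneq `|q - p| 0; first exact: powR_ge0.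
  rewrite -[leLHS](powRr1 (normr_ge0 _)); apply: ger_powR => //.
  by rewrite qp1 andbT lt_def n0 normr_ge0.
exists k; split=> // y z yk zk.
have [yz|/ltW zy] := leP y z; last exact: L.
by rewrite distrC (distrC y z); exact: L.
Qed.

Lemma time_C0_continuous Omega H t x : time_C0 T Omega H -> 0 <= t <= T -> Omega x -> {for x, continuous (H t)}.
Proof.
move=> H0 tT Ox; apply/cvgrPdist_le => e e0.
by apply: filterS ((H0 x Ox).2 e e0) => y /(_ t tT); rewrite distrC.
Qed.

(** A gain of one full derivative covers every Hoelder exponent up to [1]. *)
Lemma time_Ck_Cktheta k theta Omega H t : open Omega -> 0 <= theta <= 1 -> time_Ck T k.+1 Omega H -> 0 <= t <= T ->
  Cktheta k theta Omega (H t).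
Proof.
move=> oO th; elim: k H => [|k IH] H tH tT.
  apply/Cktheta0; split; first by move=> x; apply: time_C0_continuous => //; exact: time_Ck_C0 tH.
  by move=> _; exact: time_C1_locally_holder.
have [_ [H' tH' dH]] := tH; apply/CkthetaS; split.
  by move=> x Ox; have [] := dH t x tT Ox.
apply: Cktheta_eq (IH _ tH' tT) => // x Ox.
by rewrite derive1E; have [_ ->] := dH t x tT Ox.
Qed.

End Ck.

(** * Duhamel's formula *)

Section curve.
Context {R : realType}.
Notation mu := (@lebesgue_measure R).
Notation L1 f := (mu.-integrable [set: R] (EFin \o f)).
Implicit Types (f g v k : R -> R).

Lemma square_integrable_itv v (c d : R) : square_integrable v -> mu.-integrable `[c, d] (EFin \o v).
Proof.
move=> [mv vi]; apply: weighted_integrable_itv.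
apply: (@L1_le _ _ (fun y => expR (- `|y|) + v y ^+ 2)).
- apply: measurable_funM => //.
  by apply: measurableT_comp => //; exact: measurableT_comp.
- move=> y; rewrite /expR_weight normrM (ger0_norm (expR_ge0 _)).
  have e1 : expR (- `|y|) <= 1 by rewrite expR_le1 oppr_le0.
  have e0 := expR_ge0 (- `|y|).
  have := real_normK (num_real (v y)); have := normr_ge0 (v y); set n := `|v y| => n0 <-.
  have := sqr_ge0 (n - 1); nra.
- by apply: L1D => //; exact: L1_expR_Nnorm.
Qed.

(** From [`|v| <= e + v ^+ 2 / e], integrated over the interval. *)
Lemma L1_itv_le_of_L2 v (c d e : R) : c <= d -> square_integrable v -> 0 < e -> \int[mu]_x (v x ^+ 2) <= e ^+ 2 ->
  \int[mu]_(x in `[c, d]) `|v x| <= e * (d - c + 1).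
Proof.
move=> cd iv e0 ve; have [mv vi] := iv.
have i1 : mu.-integrable `[c, d] (EFin \o (fun=> e)).
  apply: measurable_bounded_integrable => //; last exact: bounded_cst.
  by rewrite /= lebesgue_measure_itv/=; case: ifPn; rewrite ?ltry.
have i2 : L1 (fun x => e^-1 * v x ^+ 2) by exact: L1Z.
apply: (@le_trans _ _ (\int[mu]_(x in `[c, d]) (e + e^-1 * v x ^+ 2))).
  apply: le_Rintegral => //.
  - by apply: integrable_norm; exact: square_integrable_itv.
  - by have := integrableD _ i1 (L1_itv c d i2); exact.
  move=> x _; rewrite -subr_ge0 -(pmulr_rge0 _ e0) mulrBr mulrDr mulrA divff ?gt_eqF// mul1r.
  have := real_normK (num_real (v x)); set n := `|v x| => <-.
  have := sqr_ge0 (n - e); nra.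
rewrite RintegralD//; last exact: L1_itv.
rewrite mulrDr mulr1; apply: lerD.
  rewrite Rintegral_cst//= lebesgue_measure_itv/= lte_fin.
  by case: ltgtP cd => //= -> _; rewrite subrr.
apply: (@le_trans _ _ (\int[mu]_x (e^-1 * v x ^+ 2))).
  rewrite Rintegral_mkcond; apply: RintegralT_le => //.
    by have /(integrable_mkcond _ _).1 := L1_itv c d i2; rewrite restrict_EFin; apply.
  move=> x; rewrite patchE; case: ifP => // _.
  by rewrite mulr_ge0 ?sqr_ge0// invr_ge0 ltW.
by rewrite RintegralZl// mulrC ler_pdivrMr// -expr2.
Qed.

Lemma time_integral_increment (T s t c M : R) f : time_continuous T f -> 0 <= s <= T -> 0 <= t <= T ->
  (forall r, 0 <= r <= T -> `|t - r| <= `|t - s| -> `|f r - c| <= M) ->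
  `|\int[mu]_(r in `[0, s]) f r - \int[mu]_(r in `[0, t]) f r - (s - t) * c| <= M * `|s - t|.
Proof.
move=> cf.
have H (p q : R) : 0 <= p -> p <= q -> q <= T -> (forall r, p <= r <= q -> `|f r - c| <= M) ->
  `|\int[mu]_(r in `[0, q]) f r - \int[mu]_(r in `[0, p]) f r - (q - p) * c| <= M * `|q - p|.
  move=> p0 pq qT fM.
  have fi : mu.-integrable `[0, q] (EFin \o f) by exact: time_continuous_integrable cf (lexx 0) qT.
  have := @Rintegral_itvB _ f (BLeft 0) (BRight q) p fi; rewrite !bnd_simp => /(_ p0 pq) ->.
  have fpq : mu.-integrable `[p, q] (EFin \o f) by exact: time_continuous_integrable cf p0 qT.
  rewrite Rintegral_itv_obnd_cbnd; last first.
    by apply: integrableS fpq => //; apply: subset_itvr; rewrite bnd_simp.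
  have cc : time_continuous T (fun r => f r - c) by apply: time_continuousB => //; exact: time_continuous_cst.
  have := time_integral_bound cc p0 pq qT fM.
  rewrite (ger0_norm (_ : 0 <= q - p)) ?subr_ge0//.
  rewrite RintegralB//; last by apply: time_continuous_integrable p0 qT; exact: time_continuous_cst.
  rewrite Rintegral_cst//= lebesgue_measure_itv/= lte_fin.
  move: pq; rewrite le_eqVlt => /predU1P[->|->]; first by rewrite ltxx/= subrr mul0r mulr0.
  by rewrite /= mulrC.
move=> /andP[s0 sT] /andP[t0 tT] fM.
have [ts|st] := leP t s.
  apply: H => // r /andP[tr rs]; apply: fM; first by apply/andP; split; lra.
  rewrite !ler0_norm ?subr_le0//; lra.
rewrite (distrC s) (_ : `|_ - _| =
  `|\int[mu]_(r in `[0, t]) f r - \int[mu]_(r in `[0, s]) f r - (t - s) * c|); last first.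
  set P := Rintegral _ _ _; set Q := Rintegral _ _ _.
  by rewrite -normrN; congr (`| _ |); ring.
apply: H => //; first exact: ltW.
move=> r /andP[sr rt]; apply: fM; first by apply/andP; split; lra.
rewrite !ger0_norm ?subr_ge0//; [lra|exact: ltW].
Qed.

(** The time integral of the right-hand side of the equation, that is the smooth
    part [u t - u 0] of the solution. *)
Definition drift (u : R -> R -> R) : R -> R -> R :=
  time_integral (fun r x => - convol dhelmholtz (bbm_flux (u r)) x).

Variables (T : R) (u : R -> R -> R).
Hypothesis T0 : 0 < T.
Hypothesis uS : forall r, 0 <= r <= T -> square_integrable (u r).
Hypothesis uC : forall t, 0 <= t <= T -> forall d, 0 < d ->
  \forall r \near t, 0 <= r <= T -> \int[mu]_x ((u r x - u t x) ^+ 2) <= d.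

Lemma convol_flux_time_near k (t B e : R) : measurable_fun [set: R] k ->
  (forall z, `|k z| <= expR (- `|z|)) -> 0 <= t <= T -> 0 < e ->
  \forall r \near t, 0 <= r <= T -> forall x, `|x| <= B ->
    `|convol k (bbm_flux (u r)) x - convol k (bbm_flux (u t)) x| <= e.
Proof.
move=> mk kb tT e0.
have [d d0 H] := convol_flux_continuous B mk kb (uS tT) e0.
by apply: filterS (uC tT d0) => r Hr rT; apply: H; [exact: uS|exact: Hr].
Qed.

(** Joint continuity, uniform in time by compactness of [0, T]. *)
Lemma convol_flux_time_C0 k : measurable_fun [set: R] k -> (forall z, `|k z| <= expR (- `|z|)) ->
  (forall r, 0 <= r <= T -> continuous (convol k (bbm_flux (u r)))) ->
  time_C0 T [set: R] (fun r => convol k (bbm_flux (u r))).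
Proof.
move=> mk kb kc x _; split.
  apply/time_continuousP => t tT e e0.
  by apply: filterS (convol_flux_time_near `|x| mk kb tT e0) => r Hr rT; exact: Hr.
move=> e e0; have e3 : 0 < e / 3 by rewrite divr_gt0.
have cov : near_covering_within `[0, T]%classic.
  by apply/near_covering_withinP/compact_near_coveringP; exact: segment_compact.
have : \forall y \near x, `[0, T]%classic `<=` (fun r => `|convol k (bbm_flux (u r)) y - convol k (bbm_flux (u r)) x| <= e).
  apply: (cov R (nbhs x) (fun y r => `|convol k (bbm_flux (u r)) y - convol k (bbm_flux (u r)) x| <= e)).
  move=> t /=; rewrite in_itv/= => tT.
  exists ([set r | 0 <= r <= T -> forall z, `|z| <= `|x| + 1 ->
      `|convol k (bbm_flux (u r)) z - convol k (bbm_flux (u t)) z| <= e / 3],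
    [set y | `|y| <= `|x| + 1 /\ `|convol k (bbm_flux (u t)) y - convol k (bbm_flux (u t)) x| <= e / 3]).
    split; first exact: convol_flux_time_near.
    have /cvgrPdist_le/(_ _ e3) c1 := kc t tT x.
    have /cvgrPdist_le/(_ _ (@ltr01 R)) c2 : y @[y --> x] --> x by exact: cvg_id.
    near=> y; split.
      have : `|x - y| <= 1 by near: y.
      by have := ler_normD (y - x) x; rewrite subrK distrC; lra.
    by rewrite distrC; near: y.
  move=> [r y] /= [Hr [yx Hy]] rT; rewrite in_itv/= in rT.
  have h1 := Hr rT y yx; have h2 := Hr rT x ltac:(by rewrite lerDl).
  rewrite distrC in h2.
  have := ler_distD (convol k (bbm_flux (u t)) y) (convol k (bbm_flux (u r)) y) (convol k (bbm_flux (u r)) x).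
  have := ler_distD (convol k (bbm_flux (u t)) x) (convol k (bbm_flux (u t)) y) (convol k (bbm_flux (u r)) x).
  lra.
by apply: filterS => y Hy r rT; apply: Hy; rewrite /= in_itv.
Unshelve. all: by end_near. Qed.


Let Phi r x := convol dhelmholtz (bbm_flux (u r)) x.
Let A r x := convol helmholtz (bbm_flux (u r)) x.
Let G := drift u.

Lemma dhelmholtz_flux_time_C0 : time_C0 T [set: R] Phi.
Proof.
apply: convol_flux_time_C0; [exact: measurable_dhelmholtz|exact: dhelmholtz_bound|].
by move=> r rT; apply: convol_dhelmholtz_continuous; apply: bbm_flux_weight_L1; exact: uS.
Qed.

Lemma helmholtz_flux_time_C0 : time_C0 T [set: R] A.
Proof.
apply: convol_flux_time_C0; [exact: measurable_helmholtz|exact: helmholtz_bound|].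
by move=> r rT; apply: convol_helmholtz_continuous; apply: bbm_flux_weight_L1; exact: uS.
Qed.

Lemma velocity_time_C0 : time_C0 T [set: R] (fun r x => - Phi r x).
Proof.
have := time_C0M (@time_C0_cst _ T [set: R] (-1)) dhelmholtz_flux_time_C0.
rewrite (_ : (fun r x => _) = (fun r x => - Phi r x))//.
by apply/funext => r; apply/funext => x; rewrite mulN1r.
Qed.

Lemma drift_time_C0 : time_C0 T [set: R] G.
Proof. apply: time_C0_integral; [exact: ltW|exact: openT|exact: velocity_time_C0]. Qed.

Hypothesis uD : forall t, 0 < t < T -> forall d, 0 < d ->
  \forall s \near t, s != t -> square_integrable (fun x => (u s x - u t x) / (s - t) + Phi t x) /\
    \int[mu]_x (((u s x - u t x) / (s - t) + Phi t x) ^+ 2) <= d.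

Section interval.
Variables (c d : R).
Hypothesis cd : c <= d.
Let B : R := Num.max `|c| `|d|.

Lemma itv_norm_le_max x : c <= x <= d -> `|x| <= B.
Proof.
move=> /andP[cx xd]; rewrite /B le_max; have [x0|x0] := leP 0 x.
  by apply/orP; right; rewrite (ger0_norm x0) (le_trans xd)// ler_norm.
by apply/orP; left; rewrite (ltr0_norm x0) -(normrN c) (le_trans _ (ler_norm (- c)))//; lra.
Qed.

Let F t x := u t x - u 0 x - G t x.
Let D t := \int[mu]_(x in `[c, d]) `|F t x|.

Lemma drift_continuous t : 0 <= t <= T -> continuous (G t).
Proof.
by move=> tT x; exact: (time_C0_continuous drift_time_C0 tT).
Qed.

Lemma drift_integrable t : 0 <= t <= T -> mu.-integrable `[c, d] (EFin \o G t).
Proof.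
move=> tT; apply: continuous_compact_integrable; first exact: segment_compact.
by apply: continuous_subspaceT; exact: drift_continuous.
Qed.

Lemma zero_in_time : 0 <= (0 : R) <= T. Proof. by rewrite lexx ltW. Qed.

Lemma defect_integrable t : 0 <= t <= T -> mu.-integrable `[c, d] (EFin \o F t).
Proof.
move=> tT.
have i1 := integrableB _ (square_integrable_itv c d (uS tT)) (square_integrable_itv c d (uS zero_in_time)).
by have := integrableB _ (i1 (measurable_itv _)) (drift_integrable tT); exact.
Qed.

Lemma defect_norm_dist s t (K e : R) (q : R -> R) (a : R) : 0 <= s <= T -> 0 <= t <= T -> 0 <= K ->
  square_integrable q -> 0 < e -> \int[mu]_x (q x ^+ 2) <= e ^+ 2 ->
  (forall x, c <= x <= d -> `|F s x - F t x| <= a * `|q x| + K) -> 0 <= a ->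
  `|D s - D t| <= a * (e * (d - c + 1)) + K * (d - c).
Proof.
move=> sT tT K0 qi e0 qe FK a0.
have Fs := defect_integrable sT; have Ft := defect_integrable tT.
have i1 := integrable_norm Fs; have i2 := integrable_norm Ft.
have qi' : mu.-integrable `[c, d] (EFin \o (fun x => `|q x|)) by apply: integrable_norm; exact: square_integrable_itv.
have aq : mu.-integrable `[c, d] (EFin \o (fun x => a * `|q x|)).
  by have := integrableZl _ a qi'; exact.
have ki : mu.-integrable `[c, d] (EFin \o (fun=> K)).
  apply: measurable_bounded_integrable => //; last exact: bounded_cst.
  by rewrite /= lebesgue_measure_itv/=; case: ifPn; rewrite ?ltry.
rewrite /D -RintegralB//.
have i3 : mu.-integrable `[c, d] (EFin \o (fun x => `|F s x| - `|F t x|)).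
  by have := integrableB _ i1 i2; exact.
rewrite (le_trans (le_normr_Rintegral _ i3))//.
apply: (@le_trans _ _ (\int[mu]_(x in `[c, d]) (a * `|q x| + K))).
  apply: le_Rintegral => //.
  - exact: integrable_norm.
  - by have := integrableD _ aq ki; exact.
  - move=> x; rewrite /= in_itv/= => xcd; apply: le_trans (FK x xcd).
    exact: ler_dist_dist.
rewrite RintegralD// RintegralZl//; apply: lerD.
  by rewrite ler_wpM2l// L1_itv_le_of_L2.
rewrite Rintegral_cst//= lebesgue_measure_itv/= lte_fin.
by case: ltgtP cd => //= -> _; rewrite subrr.
Qed.

Lemma drift_increment t s (K : R) (cc : R -> R) : 0 <= s <= T -> 0 <= t <= T ->
  (forall r, 0 <= r <= T -> `|t - r| <= `|t - s| -> forall x, `|x| <= B -> `|- Phi r x - cc x| <= K) ->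
  forall x, c <= x <= d -> `|G s x - G t x - (s - t) * cc x| <= K * `|s - t|.
Proof.
move=> sT tT H x xcd; apply: (@time_integral_increment T) => //.
  exact: (@velocity_time_C0 x Logic.I).1.
by move=> r rT rs; apply: H => //; exact: itv_norm_le_max.
Qed.

Lemma defect_norm_time_continuous : time_continuous T D.
Proof.
apply/time_continuousP => t tT e e0.
pose E := \int[mu]_y expR (- `|y|) + \int[mu]_y (u t y ^+ 2).
have E0 : 0 <= E.
  by apply: addr_ge0; apply: Rintegral_ge0 => y _; [exact: expR_ge0|exact: sqr_ge0].
(* a bound of the drift velocity on [c, d] for times close to [t] *)
pose K := expR B * E + 1.
have K0 : 0 < K by rewrite ltr_wpDl// mulr_ge0// expR_ge0.
pose L := d - c + 1.
have L0 : 0 < L by rewrite /L; move: cd; lra.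
pose h := e / (2 * L); have h0 : 0 < h by rewrite divr_gt0// mulr_gt0.
have he : e = 2 * (h * L) by rewrite /h; field; rewrite gt_eqF.
have /nbhs_ballP[dl /= dl0 Hd] := convol_flux_time_near B measurable_dhelmholtz dhelmholtz_bound tT (@ltr01 R).
(* [h] is chosen so that the contributions of [u] and [G] add up to [e] *)
have C1 := uC tT (exprn_gt0 2 h0).
near=> s => sT.
have st1 : `|t - s| < dl by near: s; apply/nbhs_ballP; exists dl.
have st2 : `|s - t| * K <= h.
  rewrite -ler_pdivlMr// distrC; near: s; apply/nbhs_ballP; exists (h / K).
    by rewrite /= divr_gt0.
  by move=> y /ltW.
have us : \int[mu]_x ((u s x - u t x) ^+ 2) <= h ^+ 2.
  have : 0 <= s <= T -> \int[mu]_x ((u s x - u t x) ^+ 2) <= h ^+ 2 by near: s.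
  exact.
apply: (@le_trans _ _ (1 * (h * (d - c + 1)) + (K * `|s - t|) * (d - c))).
  apply: (defect_norm_dist sT tT _ (square_integrableB (uS sT) (uS tT)) h0 us) => //.
    by rewrite mulr_ge0// ltW.
  move=> x xcd; rewrite mul1r (_ : F s x - F t x = (u s x - u t x) - (G s x - G t x)); last by rewrite /F; ring.
  rewrite (le_trans (ler_normB _ _))// lerD2l.
  have := @drift_increment t s K (fun=> 0) sT tT _ x xcd; rewrite mulr0 subr0; apply.
  move=> r rT rs y yB; rewrite subr0 normrN.
  have h1 : `|Phi r y - Phi t y| <= 1 by apply: (Hd r) => //; rewrite /ball/= (le_lt_trans rs).
  have h2 : `|Phi t y| <= expR B * E.
    apply: le_trans (convol_flux_bound y measurable_dhelmholtz dhelmholtz_bound (uS tT)) _.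
    by rewrite ler_wpM2r// ler_expR.
  have := ler_normD (Phi r y - Phi t y) (Phi t y); rewrite subrK /K; lra.
rewrite mul1r he (mulrC K).
have : `|s - t| * K * (d - c) <= h * L.
  by apply: ler_pM => //; rewrite ?mulr_ge0 ?(ltW K0) ?subr_ge0// /L; lra.
rewrite -/L; lra.
Unshelve. all: by end_near. Qed.

(** The increment of [F] between [t] and [s] is [s - t] times the error of the
    difference quotient of [u], small in L^2, minus that for [G], which is small uniformly on
    [c, d]; both are [o(s - t)] in L^1(c, d). *)
Lemma defect_norm_derive t : 0 < t < T -> is_derive t 1 D 0.
Proof.
move=> tT'; have /andP[t0 tT1] := tT'.
have tT : 0 <= t <= T by rewrite !ltW.
apply: is_derive_eps => e e0.
pose L := d - c + 1.
have L0 : 0 < L by rewrite /L; move: cd; lra.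
pose h := e / (2 * L); have h0 : 0 < h by rewrite divr_gt0// mulr_gt0.
have he : e = 2 * (h * L) by rewrite /h; field; rewrite gt_eqF.
have /nbhs_ballP[dl /= dl0 Hd] := convol_flux_time_near B measurable_dhelmholtz dhelmholtz_bound tT h0.
have C1 := uD tT' (exprn_gt0 2 h0).
near=> s; have [->|st] := eqVneq s t.
  by rewrite !subrr mul0r subrr normr0 mulr0.
have sT : 0 <= s <= T.
  apply/andP; split; apply: ltW; near: s; [exact: lt_nbhsr|exact: lt_nbhsl].
have st1 : `|t - s| < dl by near: s; apply/nbhs_ballP; exists dl.
have [qi qh] : square_integrable (fun x => (u s x - u t x) / (s - t) + Phi t x) /\
    \int[mu]_x (((u s x - u t x) / (s - t) + Phi t x) ^+ 2) <= h ^+ 2.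
  have : s != t -> square_integrable (fun x => (u s x - u t x) / (s - t) + Phi t x) /\
    \int[mu]_x (((u s x - u t x) / (s - t) + Phi t x) ^+ 2) <= h ^+ 2 by near: s.
  exact.
rewrite mulr0 subr0.
have st0 : s - t != 0 by rewrite subr_eq0.
apply: (@le_trans _ _ (`|s - t| * (h * (d - c + 1)) + (h * `|s - t|) * (d - c))).
  apply: (defect_norm_dist sT tT _ qi h0 qh) => //.
    by rewrite mulr_ge0// ltW.
  move=> x xcd.
  have := @drift_increment t s h (fun x => - Phi t x) sT tT _ x xcd => HG.
  rewrite (_ : F s x - F t x = (s - t) * ((u s x - u t x) / (s - t) + Phi t x) - (G s x - G t x - (s - t) * - Phi t x)); last by rewrite /F; field.
  rewrite (le_trans (ler_normB _ _))// normrM lerD2l; apply: HG.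
  move=> r rT rs y yB; rewrite -opprD normrN.
  by apply: (Hd r) => //; rewrite /ball/= (le_lt_trans rs).
rewrite he -/L; have : h * `|s - t| * (d - c) <= h * `|s - t| * L.
  by apply: (ler_wpM2l (mulr_ge0 (ltW h0) (normr_ge0 _))); rewrite /L; lra.
lra.
Unshelve. all: by end_near. Qed.

(** The function [D] is continuous on [0, T], vanishes at [0] and has zero
    derivative inside: the curve [u] is determined by its L^2 derivative. *)
Lemma defect_norm_eq0 t : 0 <= t <= T -> D t = 0.
Proof.
move=> /andP[t0 tT].
have [z| |z _] := @MVT_segment _ D (fun=> 0) 0 t t0.
- rewrite in_itv/= => /andP[z0 zt]; apply: defect_norm_derive; rewrite z0/=; lra.
- exact: time_continuous_sub defect_norm_time_continuous (lexx 0) tT.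
rewrite mul0r => /eqP; rewrite subr_eq0 => /eqP ->.
rewrite /D (_ : \int[mu]_(x in _) _ = \int[mu]_(x in `[c, d]) 0).
  by rewrite Rintegral_cst// mul0r.
apply: eq_Rintegral => x _; rewrite /F subrr /G /drift /time_integral set_itv1 Rintegral_set1 subr0.
by rewrite normr0.
Qed.

(** The L^1 norm of [F t] over [c, d] vanishes. Working on a bounded interval avoids
    any estimate of [G t] at infinity. *)
Lemma duhamel_itv t : 0 <= t <= T ->
  {ae mu, forall x, c <= x <= d -> u t x = u 0 x + G t x}.
Proof.
move=> tT; have Fi := defect_integrable tT.
have : (\int[mu]_(x in `[c, d]) `|(EFin \o F t) x| = 0)%E.
  have := defect_norm_eq0 tT; rewrite /D /Rintegral => H.
  rewrite -(@fineK _ (\int[mu]_(x in `[c, d]) `|(EFin \o F t) x|)%E).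
    by rewrite -[fine _]/(fine _) H.
  exact: (integrable_fin_num _ (integrable_norm Fi)).
move=> /ae_eq_integral_abs => H.
have := H (measurable_itv _) (measurable_int mu Fi) => {}H.
apply: ae_mono H => x H xcd.
have /= := H; rewrite in_itv/= => /(_ xcd) [] /eqP.
by rewrite /F subr_eq0 subr_eq => /eqP ->; rewrite addrC.
Qed.

End interval.

End curve.

(** * Propagation of regularity *)

Section solution.
Context {R : realType}.
Notation mu := (@lebesgue_measure R).
Implicit Types (f g v : R -> R).

Lemma time_Ck_slice (T : R) n Omega (H : R -> R -> R) t : 0 <= t <= T -> time_Ck T n Omega H -> time_Ck T n Omega (fun _ => H t).
Proof.
move=> tT.
have base (K : R -> R -> R) : time_C0 T Omega K -> time_C0 T Omega (fun _ => K t).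
  move=> K0 x Ox; split; first exact: time_continuous_cst.
  by move=> e e0; apply: filterS ((K0 x Ox).2 e e0) => y Hy r _; exact: Hy.
elim: n H => [|n IH] H [H0 H1]; (split; first exact: base) => //.
have [H' tH' dH] := H1; exists (fun _ => H' t); first exact: IH.
by move=> r x _ Ox; exact: dH.
Qed.

Variables (T s : R) (u0 : R -> R) (u : R -> R -> R).
Hypothesis T0 : 0 < T.
Hypothesis s0 : 0 <= s.
Hypothesis hu : bbm_solution s T u0 u.

Lemma solution_sqint r : 0 <= r <= T -> square_integrable (u r).
Proof.
case: hu => [cu _ _] rT; have [|[uL _] _] := cu r; first by rewrite in_itv.
exact: Lfun_square_integrable.
Qed.

Lemma solution_L2_continuous t : 0 <= t <= T -> forall d, 0 < d ->
  \forall r \near t, 0 <= r <= T -> \int[mu]_x ((u r x - u t x) ^+ 2) <= d.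
Proof.
move=> tT d d0; case: hu => [cu _ _]; have [|_ cv] := cu t; first by rewrite in_itv.
pose e := Num.sqrt d / 2.
have e0 : 0 < e by rewrite divr_gt0// sqrtr_gt0.
have Ne : nbhs (0%E : \bar R) [set y | (y < e%:E)%E].
  by apply: open_ereal_lt'; rewrite lte_fin.
have H : nbhs t (fun r => `[0, T]%classic r -> (Hs_norm s (fun x => (u r x - u t x)%R) < e%:E)%E).
  by move: Ne => /cv.
apply: filterS H => r Hr rT.
have := plancherel_Hs (square_integrableB (solution_sqint rT) (solution_sqint tT)) s0 e0 (Hr _).
rewrite (_ : 4 * e ^+ 2 = d).
  by apply; rewrite /= in_itv.
by rewrite /e exprMn exprVn sqr_sqrtr ?(ltW d0)//; field.
Qed.

(** The difference quotient of the equation, in terms of the second time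
    [r = t + h]. *)
Lemma solution_L2_derivable t : 0 < t < T -> forall d, 0 < d ->
  \forall r \near t, r != t ->
    square_integrable (fun x => (u r x - u t x) / (r - t) + convol dhelmholtz (bbm_flux (u t)) x) /\
    \int[mu]_x (((u r x - u t x) / (r - t) + convol dhelmholtz (bbm_flux (u t)) x) ^+ 2) <= d.
Proof.
move=> tT d d0; case: hu => [_ _ du]; have := du t; rewrite in_itv/= => /(_ tT) cv.
have /andP[t0 tT1] := tT.
have tT' : 0 <= t <= T by rewrite !ltW.
pose e := Num.sqrt d.
have e0 : 0 < e by rewrite sqrtr_gt0.
have [dl /= dl0 H] := L2norm_cvg0_near _ e0 cv.
near=> r => rt.
have rT : 0 <= r <= T.
  apply/andP; split; apply: ltW; near: r; [exact: lt_nbhsr|exact: lt_nbhsl].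
have rd : `|t - r| < dl by near: r; apply/nbhs_ballP; exists dl.
have rt0 : r - t != 0 by rewrite subr_eq0.
have := H (r - t); rewrite /ball_/= sub0r opprB => /(_ rd rt0).
rewrite addrC subrK bbm_rhsE; last exact: solution_sqint.
rewrite (_ : (fun x => _) = (fun x => (u r x - u t x) / (r - t) + convol dhelmholtz (bbm_flux (u t)) x)); last first.
  by apply/funext => x; rewrite opprK.
move=> /L2norm_le -[||//].
- have [mr _] := solution_sqint rT; have [mt _] := solution_sqint tT'.
  apply: measurable_funD.
    by apply: measurable_funM => //; exact: measurable_funB.
  apply: continuous_measurable_fun; apply: convol_dhelmholtz_continuous; apply: bbm_flux_weight_L1.
  exact: solution_sqint.
- exact: ltW.
by rewrite sqr_sqrtr// ltW.
Unshelve. all: by end_near. Qed.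

Lemma duhamel (c d t : R) : c <= d -> 0 <= t <= T ->
  {ae mu, forall x, c <= x <= d -> u t x = u 0 x + drift u t x}.
Proof.
move=> cd tT.
exact: (duhamel_itv T0 solution_sqint solution_L2_continuous solution_L2_derivable cd tT).
Qed.

Section interval.
Variables c d : R.
Hypothesis cd : c < d.
Let Omega : set R := `]c, d[%classic.

Lemma OmegaP x : Omega x <-> c < x < d.
Proof. by rewrite /Omega/= in_itv. Qed.

Lemma open_Omega : open Omega.
Proof. exact: interval_open. Qed.

(** The bootstrap step. If [u 0] and the drift are of class C^j on [Omega], then
    so is the flux; the convolutions of the flux with [helmholtz] and [dhelmholtz] are then of
    class C^(j+1), because the derivatives of [A] and [Phi] are [Phi] and [A - W];
    and so is the drift, which is the time integral of [- Phi]. *)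
Lemma drift_bootstrap j g : {ae mu, forall x, Omega x -> g x = u 0 x} ->
  time_Ck T j Omega (fun _ => g) -> time_Ck T j Omega (drift u) -> time_Ck T j.+1 Omega (drift u).
Proof.
move=> gu tg tG.
pose U r x := g x + drift u r x.
have tU : time_Ck T j Omega U by exact: time_CkD tg tG.
pose W r x := U r x + 2^-1 * (U r x * U r x).
have tW : time_Ck T j Omega W by apply: time_CkD => //; apply: time_CkZ; exact: time_CkM.
pose Phi r x := convol dhelmholtz (bbm_flux (u r)) x.
pose A r x := convol helmholtz (bbm_flux (u r)) x.
have wi r : 0 <= r <= T -> (mu.-integrable [set: R] (EFin \o expR_weight (bbm_flux (u r)))).
  by move=> rT; apply: bbm_flux_weight_L1; exact: solution_sqint.
have dA r x : 0 <= r <= T -> Omega x -> is_derive x 1 (A r) (Phi r x).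
  by move=> rT _; apply: convol_helmholtz_derive; exact: wi.
have dPh r x : 0 <= r <= T -> Omega x -> is_derive x 1 (Phi r) (A r x - W r x).
  move=> rT /OmegaP xcd; apply: (convol_dhelmholtz_derive (wi r rT) xcd).
    apply: ae_mono (ae_and gu (duhamel (ltW cd) rT)) => y [gy uy] ycd.
    have /andP[cy yd] := ycd.
    rewrite /bbm_flux uy ?ltW// -gy; last exact/OmegaP.
    by rewrite /W /U expr2; ring.
  by move=> y /OmegaP Oy; apply: time_C0_continuous rT Oy; exact: time_Ck_C0 tW.
have sub H : time_C0 T [set: R] H -> time_C0 T Omega H by move=> H0 x _; exact: H0.
have A0 : time_C0 T Omega A by apply: sub; exact: helmholtz_flux_time_C0 solution_sqint solution_L2_continuous.
have Ph0 : time_C0 T Omega Phi by apply: sub; exact: dhelmholtz_flux_time_C0 solution_sqint solution_L2_continuous.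
have tAP i : (i <= j.+1)%N -> time_Ck T i Omega A /\ time_Ck T i Omega Phi.
  elim: i => [|i IH] ij; first by split.
  have [tA tP] := IH (ltnW ij).
  split; split=> //; first by exists Phi.
  exists (fun r x => A r x - W r x) => //.
  apply: (@eq_time_Ck _ _ _ _ (fun r x => A r x + (-1) * W r x)).
    by move=> r x; rewrite mulN1r.
  by apply: time_CkD => //; apply: time_CkZ; exact: time_Ck_le tW.
have [_ tP] := tAP _ (leqnn _).
apply: time_Ck_integral; [exact: ltW|exact: open_Omega|].
apply: (@eq_time_Ck _ _ _ _ (fun r x => (-1) * Phi r x)); first by move=> r x; rewrite mulN1r.
exact: time_CkZ.
Qed.

Lemma drift_time_C0_itv : time_Ck T 0 Omega (drift u).
Proof.
split=> // x _; exact: (drift_time_C0 T0 solution_sqint solution_L2_continuous).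
Qed.

(** The hypothesis on [g] is stated conditionally on the regularity of the drift
    because, in the backward direction, [g] is obtained by subtracting the drift
    from the solution at time [t]: its regularity is only known one order at a
    time. *)
Lemma drift_time_Ck k g : {ae mu, forall x, Omega x -> g x = u 0 x} ->
  (forall j, (j <= k)%N -> time_Ck T j Omega (drift u) -> time_Ck T j Omega (fun _ => g)) ->
  time_Ck T k.+1 Omega (drift u).
Proof.
move=> gu tg.
suff H : forall j, (j <= k.+1)%N -> time_Ck T j Omega (drift u) by exact: (H k.+1 (leqnn _)).
elim=> [|j IH] jk; first exact: drift_time_C0_itv.
have tj := IH (ltnW jk).
exact: (drift_bootstrap gu (tg j jk tj) tj).
Qed.

(** The drift is one derivative smoother than the less regular of [u 0] and
    [u t], so that neither of them can be smoother than the other. *)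
Lemma regularity_propagates k theta t : 0 <= theta < 1 -> 0 <= t <= T ->
  restr_in_Cktheta k theta Omega (u 0) <-> restr_in_Cktheta k theta Omega (u t).
Proof.
move=> /andP[th0 th1] tT.
have th : 0 <= theta <= 1 by rewrite th0 ltW.
have oO := open_Omega.
have uD := duhamel (ltW cd) tT.
split=> -[g gu gC].
  exists (fun x => g x + drift u t x).
    apply: ae_mono (ae_and gu uD) => x [gx ux] Ox.
    have /OmegaP/andP[cx xd] := Ox.
    by rewrite ux ?ltW// gx.
  apply: CkthetaD => //; apply: (time_Ck_Cktheta oO th _ tT).
  apply: drift_time_Ck gu _ => j jk _; apply: time_Ck_le jk _; exact: Cktheta_time_Ck gC.
pose h x := g x - drift u t x.
have hu0 : {ae mu, forall x, Omega x -> h x = u 0 x}.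
  apply: ae_mono (ae_and gu uD) => x [gx ux] Ox.
  have /OmegaP/andP[cx xd] := Ox.
  by rewrite /h gx// ux ?ltW// addrK.
exists h => //.
have tG : time_Ck T k.+1 Omega (drift u).
  apply: drift_time_Ck hu0 _ => j jk tj.
  have tg : time_Ck T j Omega (fun _ => g) by apply: time_Ck_le jk _; exact: Cktheta_time_Ck gC.
  apply: (@eq_time_Ck _ _ _ _ (fun r x => g x + (-1) * drift u t x)).
    by move=> r x; rewrite mulN1r.
  by apply: time_CkD => //; apply: time_CkZ; exact: time_Ck_slice.
apply: CkthetaD => //; apply: CkthetaN => //.
exact: (time_Ck_Cktheta oO th tG tT).
Qed.

End interval.
End solution.

Theorem corollary1p7 (R : realType) (s : R) (hs : 0 <= s)
  (u0 : R -> R) (hu0 : inHs s u0)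
  (a x0 b : R) (hax0 : a < x0) (hx0b : x0 < b)
  (k : nat) (theta : R) (htheta0 : 0 <= theta) (htheta1 : theta < 1)
  (hleft : restr_in_Cktheta k theta `]a, x0[ u0)
  (hright : restr_in_Cktheta k theta `]x0, b[ u0)
  (hnot : ~ restr_in_Cktheta k theta `]a, b[ u0)
  (T : R) (hT : 0 < T) (u : R -> R -> R) (hu : bbm_solution s T u0 u)
  (t : R) (ht : t \in `[0, T]) :
  [/\ restr_in_Cktheta k theta `]a, x0[ (u t),
      restr_in_Cktheta k theta `]x0, b[ (u t) &
      ~ restr_in_Cktheta k theta `]a, b[ (u t)].
Proof.
have u00 : u 0 = u0 %[ae @lebesgue_measure R] by case: hu.
have tT : 0 <= t <= T by rewrite in_itv/= in ht.
have th : 0 <= theta < 1 by rewrite htheta0.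
have initial (Omega : set R) :
    restr_in_Cktheta k theta Omega u0 <-> restr_in_Cktheta k theta Omega (u 0).
  split=> -[g gu gC]; exists g => //; apply: ae_mono (ae_and gu u00) => x [gx ux] Ox.
    by rewrite gx// ux.
  by rewrite gx// ux.
have propagates c d : c < d ->
    restr_in_Cktheta k theta `]c, d[ u0 <-> restr_in_Cktheta k theta `]c, d[ (u t).
  move=> cd; apply: (iff_trans (initial _)).
  exact: (regularity_propagates hT hs hu cd k th tT).
split.
- exact: (propagates _ _ hax0).1 hleft.
- exact: (propagates _ _ hx0b).1 hright.
- by move=> /(propagates _ _ (lt_trans hax0 hx0b)).2/hnot.
Qed.
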